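(* There is an absolute constant $c>0$ such that the following holds. Let $F$ be a field of odd positive characteristic $p$, and let $A\subset F_*=F\setminus\{0\}$ be a finite set with $|A|>1$ and $|A|<p^{3/5}$. Then: (a) $$|A+A|^3\,|A^2+A^2|^4\ \ge\ c\,|A|^8\qquad\text{and}\qquad |A+A^2|\ \ge\ c\,|A|^{11/10};$$ (b) $$|A-A|^3\,|A^3+A^3|\ \ge\ c\,|A|^{17/4}\qquad\text{and}\qquad |A+A^3|\ \ge\ c\,|A|^{29/28}.$$
   Context: For finite sets $X,Y\subset F$, $X\pm Y=\{x\pm y: x\in X,y\in Y\}$. For an integer $d$, $A^d=\{a^d: a\in A\}$ is the set of $d$-th powers of elements of $A$; so e.g. $A+A^2=\{a+b^2: a,b\in A\}$. *)

(* Defs.v *)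
From mathcomp Require Import all_boot all_order all_algebra.
From mathcomp Require Import finmap.

Set Implicit Arguments.
Unset Strict Implicit.
Unset Printing Implicit Defensive.

Import GRing.Theory.
Local Open Scope fset_scope.
Local Open Scope ring_scope.

Definition sumset (V : zmodType) (X Y : {fset V}) : {fset V} :=
  [fset x + y | x in X, y in Y].

Definition diffset (V : zmodType) (X Y : {fset V}) : {fset V} :=
  [fset x - y | x in X, y in Y].

(* The set of d-th powers of elements of A, not the d-fold product set; for
   d < 0 this is meaningful when 0 \notin A. *)
Definition powset (F : fieldType) (A : {fset F}) (d : int) : {fset F} :=
  [fset a ^ d | a in A].

(* Main.v *)
(** The two inequalities in (a) and the two in (b) follow from an incidence bound of
    Rudnev type, [I ^ 2 << N ^ 3] for [N] points and [N] planes, which is proved here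
    by the polynomial method.

    Over K = F(t) the points and planes become two families of lines in K^3: the
    x-lines v = b, w = c u + d and the y-lines w = d, v = a u + b, a point lying on a
    plane exactly when its x-line meets the y-line of the plane; the transcendental t
    makes all the b's (and all the d's) distinct.  A polynomial Q of degree O(sqrt N)
    vanishes on a quarter of the x-lines.  A y-line not contained in Z(Q) meets few of
    these, so consider an irreducible factor q of Q.  If q does not divide
    its second-order contact polynomial [flec q] in the horizontal direction, then by
    Bezout Z(q) contains only O(deg(q)^2) y-lines, and these are treated recursively.
    Otherwise, as deg q < p, Z(q) is ruled by horizontal lines, and then each x-line in
    Z(q) is a directrix: it meets all y-lines in Z(q).  So the remaining incidences
    form complete bipartite graphs, and these are small because two x-lines have few
    common neighbours.

    Energies of the form u v + f(u) + g(v) + w are counts of such incidences.  For (a)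
    write a = (a + e) - e in a^2; for (b) use 4 (a^3 - b^3) = (a - b)^3
    + 3 (a - b) (a + b)^2. *)

Require Import Defs.
From HB Require Import structures.
From mathcomp Require Import all_boot all_order all_algebra.
From mathcomp Require Import perm polyXY fraction finmap.
From mathcomp Require Import boolp reals exp.
From mathcomp Require Import ring zify.

Set Implicit Arguments.
Unset Strict Implicit.
Unset Printing Implicit Defensive.

Import Order.TTheory GRing.Theory Num.Theory Pdiv.Idomain.

Local Open Scope ring_scope.

(** * Factorization in polynomial rings *)

(** Divisibility in the ring itself; over a domain, [%|] on polynomials also allows scaling by
    nonzero constants. *)
Definition rdvd (R : comNzRingType) (a b : R) := exists c, b = c * a.

Definition rprime (R : idomainType) (a : R) :=
  [/\ a != 0, a \isn't a GRing.unit &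
      forall x y, rdvd a (x * y) -> rdvd a x \/ rdvd a y].

Definition factorization (R : idomainType) (a e : R) (s : seq R) :=
  [/\ e \is a GRing.unit, forall q, q \in s -> rprime q &
      a = e * \prod_(q <- s) q].

Definition factorial_domain (R : idomainType) :=
  forall a : R, a != 0 -> exists e s, factorization a e s.

Section RDvd.
Variable R : idomainType.
Implicit Types a b c : R.

Lemma rdvd_mulr a b c : rdvd a b -> rdvd a (b * c).
Proof. by case=> x ->; exists (x * c); rewrite mulrAC. Qed.

Lemma rdvd_mull a b c : rdvd a b -> rdvd a (c * b).
Proof. by rewrite mulrC; apply: rdvd_mulr. Qed.

Lemma rdvdD a b c : rdvd a b -> rdvd a c -> rdvd a (b + c).
Proof. by move=> [x ->] [y ->]; exists (x + y); rewrite mulrDl. Qed.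

Lemma rdvdN a b : rdvd a b -> rdvd a (- b).
Proof. by move=> [x ->]; exists (- x); rewrite mulNr. Qed.

Lemma rdvdB a b c : rdvd a b -> rdvd a c -> rdvd a (b - c).
Proof. by move=> ab /rdvdN; apply: rdvdD. Qed.

Lemma rprime_ndvd_unit a e : rprime a -> e \is a GRing.unit -> ~ rdvd a e.
Proof.
by case=> _ /negP na _ ue [c ec]; apply: na; move: ue; rewrite ec unitrM => /andP[].
Qed.

Lemma rprime_prod a (s : seq R) :
  rprime a -> rdvd a (\prod_(q <- s) q) -> exists2 q, q \in s & rdvd a q.
Proof.
move=> pa; elim: s => [|q s IH].
  by rewrite big_nil => /(rprime_ndvd_unit pa (unitr1 _)).
rewrite big_cons; case: (pa) => _ _ pr /pr[aq|/IH[r rs ar]].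
  by exists q; rewrite ?mem_head.
by exists r => //; rewrite in_cons rs orbT.
Qed.

Lemma rprime_assoc a b : rprime a -> rprime b -> rdvd a b ->
  exists2 u, u \is a GRing.unit & b = u * a.
Proof.
move=> [a0 /negP na _] [b0 _ pb] [c bc]; exists c => //.
have /pb[[d cd]|[d ad]] : rdvd b (c * a) by rewrite -bc; exists 1; rewrite mul1r.
  case: na; apply/unitrPr; exists d; apply: (mulIf b0).
  by rewrite mul1r [RHS]bc cd; ring.
by apply/unitrPr; exists d; apply: (mulIf b0); rewrite mul1r [RHS]bc ad mulrA.
Qed.

End RDvd.

Section Gauss.
Variable R : idomainType.
Implicit Types (a b c e q : R) (f g h : {poly R}) (s : seq R).

(** Gauss's lemma: [q] divides the product of the leading coefficients, hence one of them, and that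
    leading term can be subtracted. The induction is on the sum of the sizes. *)
Lemma rprime_polyC q : rprime q -> rprime q%:P.
Proof.
move=> pq; case: (pq) => q0 nq prq; split; first by rewrite polyC_eq0.
  by rewrite poly_unitE size_polyC q0 /= coefC eqxx.
move=> f g; move: {2}(size f + size g).+1 (ltnSn (size f + size g)) => n.
elim: n f g => // n IH f g; rewrite ltnS => le_n [h fgh].
have [->|f0] := eqVneq f 0; first by left; exists 0; rewrite mul0r.
have [->|g0] := eqVneq g 0; first by right; exists 0; rewrite mul0r.
have tr (u : {poly R}) : u != 0 ->
    (size (u - lead_coef u *: 'X^((size u).-1))%R < size u)%N.
  move=> u0; have su : (0 < size u)%N by rewrite size_poly_gt0.
  rewrite -[X in (_ < X)%N](prednK su) ltnS; apply/leq_sizeP => j lej.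
  rewrite coefB coefZ coefXn; case: eqP => [->|nj]; rewrite ?mulr1 ?subrr //.
  by rewrite mulr0 subr0 nth_default // -(prednK su) ltn_neqAle lej andbT eq_sym; apply/eqP.
have lcd (u : {poly R}) : rdvd q (lead_coef u) -> rdvd q%:P (lead_coef u *: 'X^((size u).-1)).
  by case=> c ->; exists (c *: 'X^((size u).-1)); rewrite -!mul_polyC polyCM; ring.
have /prq[qf|qg] : rdvd q (lead_coef f * lead_coef g).
- by exists (lead_coef h); rewrite -lead_coefM fgh lead_coefM lead_coefC.
- have [||qf'|] := IH (f - lead_coef f *: 'X^((size f).-1)) g; last by right.
  + by apply: leq_trans le_n; rewrite ltn_add2r tr.
  + by rewrite mulrBl fgh; apply: rdvdB; [exists h|apply/rdvd_mulr/lcd].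
  + by left; rewrite -[f](subrK (lead_coef f *: 'X^((size f).-1))); apply/rdvdD/lcd.
- have [||qf'|qg'] := IH f (g - lead_coef g *: 'X^((size g).-1)); first 2 [|by left].
  + by apply: leq_trans le_n; rewrite ltn_add2l tr.
  + by rewrite mulrBr fgh; apply: rdvdB; [exists h|apply/rdvd_mull/lcd].
  + by right; rewrite -[g](subrK (lead_coef g *: 'X^((size g).-1))); apply/rdvdD/lcd.
Qed.

(** Formulated with prime constants, so that no gcd of the coefficients has to be chosen. *)
Definition primitive f := forall q, rprime q -> ~ rdvd q%:P f.

Hypothesis UR : factorial_domain R.

(** The primes of [c] are cancelled one at a time: each divides [h * f] but not the primitive [f],
    hence divides [h]. *)
Lemma primitive_cancel c f g h :
  primitive f -> c != 0 -> c%:P * g = h * f -> rdvd f g.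
Proof.
move=> pf /UR[e [s [ue ps ->]]].
have: exists2 t, t \is a GRing.unit & e%:P = t%:P :> {poly R} by exists e.
elim: s g h ps => [|q s IH] g h ps [t ut _]; rewrite ?big_nil ?big_cons.
  rewrite mulr1 => E; exists (e^-1%:P * h).
  by rewrite -mulrA -E mulrA -polyCM mulVr // mul1r.
rewrite mulrCA polyCM -mulrA => E.
have pq : rprime q by apply: ps; rewrite mem_head.
have [_ _ /(_ h f)[]] := rprime_polyC pq; last by move/pf => /(_ pq).
  by exists ((e * \prod_(j <- s) j)%:P * g); rewrite -E mulrC.
case=> h' E'; apply: (IH g h') => //; last first.
  apply: (@mulfI _ q%:P); first by rewrite polyC_eq0; case: pq.
  by rewrite E E'; ring.
  by exists e.
by move=> r rs; apply: ps; rewrite in_cons rs orbT.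
Qed.

(** Induction on the number of prime factors of the leading coefficient: a prime constant dividing
    [f] also divides that coefficient. *)
Lemma primitive_part f : f != 0 ->
  exists2 s, (forall q, q \in s -> rprime q) &
  exists2 g, primitive g & f = (\prod_(q <- s) q)%:P * g.
Proof.
move=> f0; have /UR[e [s [ue ps]]] : lead_coef f != 0 by rewrite lead_coef_eq0.
have [n] := ubnP (size s); elim: n => // n IH in f f0 e s ue ps *.
rewrite ltnS => sn lf.
case: (pselect (primitive f)) => [pf|]; first by exists [::] => //; exists f; rewrite ?big_nil ?mul1r.
move=> /existsNP[q /not_implyP[pq /contrapT[g fg]]].
have q0 : q != 0 by case: pq.
have g0 : g != 0 by apply: contraNneq f0 => g0; rewrite fg g0 mul0r.
have lfg : lead_coef f = lead_coef g * q by rewrite fg lead_coefM lead_coefC.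
have /(rprime_prod pq)[r rs qr] : rdvd q (\prod_(q <- s) q).
  by exists (e^-1 * lead_coef g); rewrite -mulrA -lfg lf mulKr.
have [u uu ru] := rprime_assoc pq (ps _ rs) qr.
have [] // := IH g g0 (e * u) (rem r s).
- by rewrite unitrM ue.
- by move=> x /mem_rem /ps.
- by apply: leq_trans sn; rewrite size_rem // prednK //; case: (s) rs.
- apply: (mulIf q0); rewrite -lfg lf (perm_big _ (perm_to_rem rs)) big_cons /= {1}ru; ring.
move=> s' ps' [h ph gh]; exists (q :: s').
  by move=> x; rewrite in_cons => /predU1P[->//|/ps'].
by exists h => //; rewrite big_cons fg gh polyCM; ring.
Qed.

(** Each prime constant divides [g] or [h], and dividing it out leaves the degree unchanged. *)
Lemma split_cancel s f g h : (forall q, q \in s -> rprime q) ->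
  (\prod_(q <- s) q)%:P * f = g * h ->
  exists g' h', [/\ f = g' * h', (f != 0 -> size g' = size g) & (f != 0 -> size h' = size h)].
Proof.
elim: s f g h => [|q s IH] f g h ps; first by rewrite big_nil mul1r => ->; exists g, h.
have pq : rprime q by apply: ps; rewrite mem_head.
have ps' x : x \in s -> rprime x by move=> xs; apply: ps; rewrite in_cons xs orbT.
have q0 : q != 0 by case: pq.
have qP0 : q%:P != 0 by rewrite polyC_eq0.
have sz (k : {poly R}) : size (k * q%:P) = size k by rewrite mulrC mul_polyC size_scale.
rewrite big_cons polyCM => E.
have [_ _ /(_ g h)[]] := rprime_polyC pq.
- by exists ((\prod_(j <- s) j)%:P * f); rewrite -E; ring.
- case=> k gk; have [|g' [h' [fE s1 s2]]] := IH f k h ps'.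
    by apply: (mulfI qP0); rewrite mulrA E gk; ring.
  by exists g', h'; split=> //; rewrite gk sz.
- case=> k hk; have [|g' [h' [fE s1 s2]]] := IH f g k ps'.
    by apply: (mulfI qP0); rewrite mulrA E hk; ring.
  by exists g', h'; split=> //; rewrite hk sz.
Qed.

Lemma primitive_dvd f g : primitive f -> rdvd g f -> primitive g.
Proof. by move=> pf [h fE] q pq qg; case: (pf q pq); rewrite fE; apply: rdvd_mull. Qed.

(* [%|] is divisibility over the field of fractions of [R]. *)
Lemma dvdp_rdvd f g : primitive f -> (f %| g) -> rdvd f g.
Proof.
move=> pf /dvdpP[[c h] /= c0 E]; apply: (primitive_cancel pf c0 (h := h)).
by rewrite mul_polyC.
Qed.

(** If [f] is irreducible over the field of fractions, its gcd with [a] is constant or an associate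
    of [f] there; primitivity brings the resulting divisibility back to the ring. *)
Lemma primitive_prime f : primitive f -> (1 < size f)%N ->
  (forall c g h, c != 0 -> c *: f = g * h -> (size g <= 1)%N || (size h <= 1)%N) ->
  rprime f.
Proof.
move=> pf sf irr; have f0 : f != 0 by rewrite -size_poly_gt0 ltnW.
split=> //.
  by rewrite poly_unitE; case: (size f) sf => [|[]].
move=> a b [k abk].
have fab : f %| a * b by rewrite abk dvdp_mull.
have [cop|ncop] := boolP (coprimep f a).
  by right; apply: dvdp_rdvd => //; rewrite -(Gauss_dvdpr b cop).
left; apply: dvdp_rdvd => //.
have /dvdpP[[c h] /= c0 E] := dvdp_gcdl f a.
have g0 : gcdp f a != 0 by rewrite gcdp_eq0 negb_and f0.
have sg : (1 < size (gcdp f a))%N.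
  by rewrite ltn_neqAle eq_sym -coprimep_def ncop size_poly_gt0.
have := irr c h (gcdp f a) c0 E; rewrite leqNgt [X in _ || X]leqNgt sg orbF -leqNgt => sh.
have fg : f %| gcdp f a.
  have h0 : h != 0.
    by apply/eqP => z; move/eqP: E; rewrite z mul0r -mul_polyC mulf_eq0 polyC_eq0 (negPf c0) (negPf f0).
  have [d hd] : exists d, h = d%:P by exists h`_0; apply: size1_polyC.
  apply/dvdpP; exists (d, c%:P) => /=; first by move: h0; rewrite hd polyC_eq0.
  by rewrite mul_polyC E hd mul_polyC.
exact: dvdp_trans fg (dvdp_gcdr _ _).
Qed.

(** Gauss's theorem. A primitive polynomial of positive degree is either irreducible over the field
    of fractions, hence prime, or splits into two primitive factors of smaller degree. *)
Lemma factorial_domain_poly : factorial_domain {poly R}.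
Proof.
have prim f : f != 0 -> primitive f -> exists (e : {poly R}) (s : seq {poly R}), factorization f e s.
  have [n] := ubnP (size f); elim: n f => // n IH f; rewrite ltnS => sn f0 pf.
  have [s1|s1] := leqP (size f) 1.
    (* A primitive constant is a unit, since any prime factor of it would divide [f]. *)
    have fC : f = (f`_0)%:P by apply: size1_polyC.
    have c0 : f`_0 != 0 by rewrite -polyC_eq0 -fC.
    have [e [s [ue ps E]]] := UR c0.
    exists f, [::]; split=> //; rewrite ?big_nil ?mulr1 //.
    case: s ps E => [|q s] ps E.
      by rewrite poly_unitE E big_nil mulr1 ue andbT fC size_polyC c0.
    have pq : rprime q by apply: ps; rewrite mem_head.
    case: (pf q pq); exists (e * \prod_(j <- s) j)%:P.
    by rewrite fC E big_cons -polyCM; congr (_%:P); ring.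
  have [irr|] := pselect (forall c g h, c != 0 -> c *: f = g * h -> (size g <= 1)%N || (size h <= 1)%N).
    exists 1, [:: f]; split; rewrite ?unitr1 ?big_seq1 ?mul1r //.
    by move=> q; rewrite inE => /eqP->; apply: primitive_prime.
  move=> /existsNP[c /existsNP[g /existsNP[h /not_implyP[c0 /not_implyP[E /negP]]]]].
  rewrite negb_or -!ltnNge => /andP[sg sh].
  have [e [s [ue ps cE]]] := UR c0.
  have [|g' [h' [fE sg' sh']]] := @split_cancel s f (e^-1%:P * g) h ps.
    apply: (@mulfI _ e%:P); first by rewrite polyC_eq0; apply: contraTneq ue => ->; rewrite unitr0.
    by rewrite !mulrA -!polyCM -cE mulrV // mul1r mul_polyC.
  have {}sg' : size g' = size g.
    by rewrite sg' // mul_polyC size_scale // invr_eq0; apply: contraTneq ue => ->; rewrite unitr0.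
  have {}sh' := sh' f0.
  have [g0 h0] : g' != 0 /\ h' != 0 by split; apply: contraNneq f0 => z; rewrite fE z ?mul0r ?mulr0.
  have sfE : size f = (size g' + size h').-1 by rewrite fE size_mul.
  have [||e1 [s1' [u1 p1 E1]]] := IH g' _ g0.
  - by apply: leq_trans sn; rewrite sfE sg' sh'; case: (size h) sh => [|[|m]] // _; rewrite !addnS /= ltnS leq_addr.
  - by apply: primitive_dvd pf _; exists h'; rewrite fE mulrC.
  have [||e2 [s2' [u2 p2 E2]]] := IH h' _ h0.
  - by apply: leq_trans sn; rewrite sfE sg' sh'; case: (size g) sg => [|[|m]] // _; rewrite !addSn /= ltnS leq_addl.
  - by apply: primitive_dvd pf _; exists g'; rewrite fE.
  exists (e1 * e2), (s1' ++ s2'); split; first by rewrite unitrM u1.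
    by move=> q; rewrite mem_cat => /orP[/p1|/p2].
  by rewrite fE E1 E2 big_cat /=; ring.
move=> f f0; have [s ps [g pg fE]] := primitive_part f0.
have g0 : g != 0 by apply: contraNneq f0 => g0; rewrite fE g0 mulr0.
have [e [t [ue pt gE]]] := prim g g0 pg.
exists e, ([seq q%:P | q <- s] ++ t); split=> //.
  by move=> q; rewrite mem_cat => /orP[/mapP[r rs ->]|/pt//]; apply/rprime_polyC/ps.
by rewrite fE gE big_cat /= big_map rmorph_prod /=; ring.
Qed.

End Gauss.

Lemma factorial_domain_field (K : fieldType) : factorial_domain K.
Proof. by move=> a a0; exists a, [::]; split; rewrite ?unitfE ?big_nil ?mulr1. Qed.

(** * Restriction to lines *)

Lemma horner2_const (R : comNzRingType) (r : {poly {poly R}}) (p : {poly R}) x :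
  r.[p].[x] = r.[(p.[x])%:P].[x].
Proof.
elim/poly_ind: r => [|r c IH]; first by rewrite !horner0.
by rewrite !hornerMXaddC !hornerD !hornerM IH hornerC.
Qed.

(* If [f] had order m >= 2 at [x], the left-hand side of the differential equation
   would have order exactly m - 2 and the right-hand side at least m - 1. *)
Lemma order2_vanish (K : fieldType) n (f g s psi : {poly K}) x :
  (forall m, (0 < m < n)%N -> m%:R != 0 :> K) -> (size f <= n)%N ->
  psi.[x] != 0 -> f.[x] = 0 -> f^`().[x] = 0 ->
  psi ^+ 2 * f^`()^`() = f * s + f^`() * g -> f = 0.
Proof.
move=> chn sf psix fx f'x E; apply/eqP/negPn/negP => f0.
have [[|[|m]] [h]] := multiplicity_XsubC f x; rewrite f0 /= => rh fE.
- by case/negP: rh; rewrite /root -fx fE mulr1.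
- case/negP: rh; rewrite /root -f'x fE expr1 derivM derivXsubC mulr1 hornerD hornerM.
  by rewrite hornerXsubC subrr mulr0 add0r.
set e := 'X - x%:P in fE; have e0 : e != 0 by rewrite polyXsubC_eq0.
have de : e^`() = 1 by rewrite derivXsubC.
have h0 : h != 0 by apply: contraNneq f0 => h0; rewrite fE h0 mul0r.
have sm : (m.+2 < size f)%N.
  rewrite fE size_mul ?expf_neq0 // size_exp_XsubC.
  by rewrite addnS /= -[X in (X < _)%N]add0n ltn_add2r size_poly_gt0.
have ex : e.[x] = 0 by rewrite hornerXsubC subrr.
move: e e0 de ex fE => e e0 de ex fE.
have [k f'E kx] : exists2 k, f^`() = k * e ^+ m.+1 & k.[x] = h.[x] *+ m.+2.
  exists (h^`() * e + h *+ m.+2); last first.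
    by rewrite hornerD hornerM ex mulr0 add0r hornerMn.
  rewrite fE derivM deriv_exp de mul1r /= (exprS e m.+1).
  by rewrite mulrDl mulrnAr mulrnAl mulrA.
have f''E : f^`()^`() = (k^`() * e + k *+ m.+1) * e ^+ m.
  rewrite f'E derivM deriv_exp de mul1r /= (exprS e m).
  by rewrite mulrDl mulrnAr mulrnAl mulrA.
have em0 : e ^+ m != 0 by rewrite expf_neq0.
have E' : psi ^+ 2 * (k^`() * e + k *+ m.+1) = h * e ^+ 2 * s + k * e * g.
  apply: (mulIf em0); rewrite -[LHS]mulrA -f''E E f'E fE !(exprS e) expr0.
  by move: (e ^+ m) => z; ring.
(* After cancelling [e ^+ m], evaluation at [x] leaves (m + 2)(m + 1) psi(x)^2 h(x) = 0. Both
   integers are nonzero in [K] because m + 2 < [size f] <= [n]. *)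
move/(congr1 (horner^~ x)): E'; rewrite !expr2 !(hornerM, hornerD, hornerMn) ex kx.
rewrite !(mulr0, mul0r, addr0, add0r) -mulrnA -mulr_natr natrM => /eqP.
rewrite !mulf_eq0 (negPf psix) /= -/(root h x) (negPf rh) /=.
by rewrite !(negPf (chn _ _)) //=; apply: leq_trans sf; rewrite // ltnW.
Qed.

Lemma size_det (R : comNzRingType) n e (A : 'M[{poly R}]_n) :
  (forall i j, size (A i j) <= e.+1)%N -> (size (\det A) <= (n * e).+1)%N.
Proof.
move=> sA; apply: leq_trans (size_sum _ _ _) _; apply/bigmax_leqP => s _.
have -> : (-1) ^+ s * \prod_i A i (s i) = ((-1) ^+ s)%:P * \prod_i A i (s i).
  by rewrite rmorph_sign.
apply: leq_trans (size_polyMleq _ _) _.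
have sC := size_polyC_leq1 ((-1) ^+ s : R).
have : (size (\prod_i A i (s i))%R <= (n * e).+1)%N; last first.
  by move: sC; move: (size _) (size _) => y z; lia.
apply: (@leq_trans (\sum_(i < n) e).+1); last by rewrite sum_nat_const card_ord.
elim/big_ind2: _ => [|p a q b sp sq|i _]; first by rewrite size_poly1.
  apply: leq_trans (size_polyMleq _ _) _.
  by move: sp sq; move: (size _) (size _) => y z; lia.
exact: sA.
Qed.

Section Lines.
Variable K : fieldType.
Local Notation T3 := {poly {poly {poly K}}}.
Implicit Types (q g : T3) (a b c d u v w : K).

(* [q] is a polynomial in v over w over u (outermost variable first); [ev_x] and
   [ev_y] restrict it to the lines v = b, w = c u + d and w = d, v = a u + b, both
   parametrized by u. *)
Definition ev_pt u v w q := (q.[v%:P%:P]).[w%:P].[u].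

Definition ev_x b c d : T3 -> {poly K} :=
  horner_eval (c *: 'X + d%:P) \o horner_eval b%:P%:P.
HB.instance Definition _ b c d := GRing.RMorphism.copy (ev_x b c d)
  (horner_eval (c *: 'X + d%:P) \o horner_eval b%:P%:P).

Definition ev_y a b d : T3 -> {poly K} :=
  horner_eval (a *: 'X + b%:P) \o map_poly (horner_eval d%:P).
HB.instance Definition _ a b d := GRing.RMorphism.copy (ev_y a b d)
  (horner_eval (a *: 'X + b%:P) \o map_poly (horner_eval d%:P)).

Definition der_u : T3 -> T3 := map_poly (map_poly (@deriv K)).

(* Second derivative of [q] along (q_v, - q_u, 0), the direction tangent to the
   section of the surface q = 0 by a plane w = const. *)
Definition flec q : T3 :=
  q^`() ^+ 2 * der_u (der_u q) - (der_u q * q^`() * (der_u q)^`()) *+ 2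
  + der_u q ^+ 2 * q^`()^`().

Lemma ev_xE b c d q : ev_x b c d q = q.[b%:P%:P].[c *: 'X + d%:P].
Proof. by []. Qed.

Lemma ev_yE a b d q : ev_y a b d q = (map_poly (horner_eval d%:P) q).[a *: 'X + b%:P].
Proof. by []. Qed.

Lemma ev_y_step a b d q (r : {poly {poly K}}) :
  ev_y a b d (q * 'X + r%:P) = ev_y a b d q * (a *: 'X + b%:P) + r.[d%:P].
Proof.
by rewrite rmorphD rmorphM /= !ev_yE map_polyX map_polyC hornerX hornerC.
Qed.

Lemma ev_x_pt b c d q u : (ev_x b c d q).[u] = ev_pt u b (c * u + d) q.
Proof. by rewrite ev_xE horner2_const !hornerE. Qed.

Lemma ev_y_pt a b d q u : (ev_y a b d q).[u] = ev_pt u (a * u + b) d q.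
Proof.
elim/poly_ind: q => [|q r IH]; first by rewrite rmorph0 /ev_pt !horner0.
rewrite ev_y_step hornerD hornerM IH /ev_pt hornerMXaddC !hornerD !hornerM !hornerC.
by rewrite hornerZ hornerX.
Qed.

Lemma der_u_step q (r : {poly {poly K}}) :
  der_u (q * 'X + r%:P) = der_u q * 'X + (map_poly (@deriv K) r)%:P.
Proof.
rewrite /der_u raddfD /= map_polyC /=; congr (_ + _).
by apply/polyP => -[|i]; rewrite coef_map !coefMX ?coef_map ?raddf0.
Qed.

Lemma deriv_horner_polyC (r : {poly {poly K}}) d :
  r.[d%:P]^`() = (map_poly (@deriv K) r).[d%:P].
Proof.
elim/poly_ind: r => [|r c IH]; first by rewrite raddf0 !horner0 deriv0.
have -> : map_poly (@deriv K) (r * 'X + c%:P) = map_poly (@deriv K) r * 'X + (c^`())%:P.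
  by apply/polyP => -[|i]; rewrite !(coef_map, coefD, coefMX, coefC, raddfD) ?add0r ?addr0 ?raddf0 /= ?addr0 ?add0r.
by rewrite !hornerMXaddC derivD derivM derivC mulr0 addr0 IH.
Qed.

(** Chain rule: along the y-line, v moves with slope [a] and w is constant. *)
Lemma deriv_ev_y a b d q :
  (ev_y a b d q)^`() = ev_y a b d (der_u q) + a%:P * ev_y a b d q^`().
Proof.
elim/poly_ind: q => [|q r IH].
  by rewrite /der_u deriv0 !raddf0 mulr0 addr0.
rewrite ev_y_step derivD derivM IH derivD derivZ derivX derivC addr0 alg_polyC.
rewrite der_u_step ev_y_step deriv_horner_polyC derivD derivM derivX mulr1 derivC addr0.
rewrite rmorphD rmorphM /= [ev_y a b d 'X]ev_yE map_polyX hornerX; ring.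
Qed.

Lemma der_u_deriv q : der_u q^`() = (der_u q)^`().
Proof.
apply/polyP => i; apply/polyP=> j.
by rewrite /der_u !(coef_map, coef_deriv) /= !coefMn coef_map /= raddfMn.
Qed.

(** On the line, q_u equals the derivative of the restriction minus [a] q_v. Substituting this into
    [flec] leaves q_v^2 times the second derivative of the restriction, modulo the first. *)
Lemma ev_y_flec a b d q : exists g : {poly K},
  ev_y a b d (flec q) =
  ev_y a b d q^`() ^+ 2 * (ev_y a b d q)^`()^`() - (ev_y a b d q)^`() * g.
Proof.
exists (ev_y a b d q^`() * ev_y a b d (der_u q)^`() *+ 2 -
  ((ev_y a b d q)^`() - a%:P * ev_y a b d q^`() *+ 2) * ev_y a b d q^`()^`()).
rewrite /flec rmorphD rmorphB rmorphMn !rmorphM /=.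
have dE (p : {poly K}) : (a%:P * p)^`() = a%:P * p^`() by rewrite derivM derivC mul0r add0r.
rewrite !deriv_ev_y derivD dE !deriv_ev_y der_u_deriv.
move: (ev_y a b d q^`()) (ev_y a b d (der_u q)) (ev_y a b d (der_u q)^`()).
move: (ev_y a b d (der_u (der_u q))) (ev_y a b d q^`()^`()).
by move: (a%:P) => *; ring.
Qed.

End Lines.

(** * Bezout for lines *)

(** A zero resultant gives a common factor [G] of positive degree over the field of fractions, with
    [c%:P * q = r * G]. The prime [q] cannot divide [r], which has smaller degree, so it divides [G]
    and then [g]. *)
Lemma rprime_resultant (R : idomainType) (q g : {poly R}) :
  rprime q -> (1 < size q)%N -> resultant q g = 0 -> rdvd q g.
Proof.
case=> q0 _ pq sq /eqP; rewrite resultant_eq0 => sG.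
have /dvdpP[[c r] /= c0 E] := dvdp_gcdl q g.
have /dvdpP[[c' r'] /= c'0 E'] := dvdp_gcdr q g.
set G := gcdp q g in sG E E'.
have ndvd (x : {poly R}) : x != 0 -> (size x < size q)%N -> ~ rdvd q x.
  move=> x0 sx [y xE]; have y0 : y != 0 by apply: contraNneq x0 => y0; rewrite xE y0 mul0r.
  move: sx; rewrite xE size_mul //; move: y0; rewrite -size_poly_gt0.
  by move: (size _) (size _) => m n; lia.
have Er : c%:P * q = r * G by rewrite mul_polyC.
have r0 : r != 0.
  by apply/eqP => r0; move/eqP: Er; rewrite r0 mul0r mulf_eq0 polyC_eq0 (negPf c0) (negPf q0).
have G0 : G != 0 by rewrite -size_poly_gt0 ltnW.
have sr : (size r < size q)%N.
  have := congr1 (fun p : {poly R} => size p) Er; rewrite size_mul ?polyC_eq0 // size_mul //.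
  by rewrite size_polyC c0; move: sG; move: (size _) (size _) (size _) => m n k; lia.
have qG : rdvd q G.
  case: (pq r G) => //; first by exists c%:P.
  by move/(ndvd _ r0 sr).
have : rdvd q (c'%:P * g) by rewrite mul_polyC E'; apply: rdvd_mull.
case/pq => // qc; case: (@ndvd c'%:P) => //; rewrite ?polyC_eq0 //.
by rewrite size_polyC c'0.
Qed.

Lemma card_roots_size (R : idomainType) (J : finType) (Y : {set J}) (d : J -> R)
    (r : {poly R}) :
  injective d -> r != 0 -> (forall j, j \in Y -> root r (d j)) ->
  (#|Y| < size r)%N.
Proof.
move=> inj_d r0 rY; rewrite cardE -(size_map d).
apply: max_poly_roots => //.
  by apply/allP => x /mapP[j]; rewrite mem_enum => /rY rj ->.
by rewrite map_inj_uniq ?enum_uniq.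
Qed.

Section Bezout.
Variables (K : fieldType) (J : finType) (a b d : J -> K).
Hypothesis inj_d : injective d.

(** The resultant eliminates v and is a polynomial in w over K[u]. It lies in the ideal of [q] and
    [g], so it vanishes at the heights w = [d j], which are distinct; the Sylvester determinant
    bounds its degree. *)
Lemma bezout_lines (q g : {poly {poly {poly K}}}) (Y : {set J}) m n e :
  rprime q -> (1 < size q)%N -> ~ rdvd q g ->
  (size q <= m.+1)%N -> (size g <= n.+1)%N ->
  (sizeY q <= e.+1)%N -> (sizeY g <= e.+1)%N ->
  (forall j, j \in Y -> ev_y (a j) (b j) (d j) q = 0 /\ ev_y (a j) (b j) (d j) g = 0) ->
  (#|Y| <= (m + n) * e)%N.
Proof.
move=> pq sq nqg sqm sgn eq eg vY.
have inj_dC : injective (fun j => (d j)%:P) by move=> i j /polyC_inj /inj_d.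
(* If [g] does not involve v, its own roots in w are counted instead. *)
have [sg|sg] := leqP (size g) 1.
  have gC : g = (g`_0)%:P by apply: size1_polyC.
  have g0 : g`_0 != 0.
    by apply/eqP => g0; apply: nqg; exists 0; rewrite mul0r gC g0.
  have : (#|Y| < size (g`_0)%R)%N.
    apply: (card_roots_size inj_dC) => // j /vY[_].
    by rewrite {1}gC ev_yE map_polyC hornerC => E; apply/eqP.
  move: (leq_trans (max_size_coefXY g 0) eg) (leq_trans sq sqm); clear.
  move: (size _) #|_| => x y; nia.
have r0 : resultant q g != 0 by apply/eqP => /(rprime_resultant pq sq).
have : (#|Y| < size (resultant q g))%N.
  apply: (card_roots_size inj_dC) => // j /vY[qj gj].
  have [[s t] /= _ E] := resultant_in_ideal sq sg.
  move/(congr1 (ev_y (a j) (b j) (d j))): E.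
  rewrite rmorphD !rmorphM /= qj gj !mulr0 addr0 ev_yE map_polyC hornerC => E.
  by apply/eqP.
have : (size (resultant q g) <= (((size g).-1 + (size q).-1) * e).+1)%N.
  apply: size_det => i j; rewrite Sylvester_mxE.
  have S0 (p : {poly {poly {poly K}}}) k (t : bool) : (sizeY p <= e.+1)%N -> (size (p`_k *+ t) <= e.+1)%N.
    by case: t; rewrite ?mulr0n ?size_poly0 // mulr1n; apply/leq_trans/max_size_coefXY.
  by case: (split i) => k; apply: S0.
move: sqm sgn sq sg; clear; move: (size _) #|_| => z t; move: (size q) (size g) => x y; nia.
Qed.

End Bezout.

(** * Degrees *)

Lemma leq_sizeY (R : nzRingType) n (q : {poly {poly R}}) : (forall k, size (q`_k)%R <= n)%N -> (sizeY q <= n)%N.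
Proof. by move=> sq; apply/bigmax_leqP => i _. Qed.

Section Degrees.
Variable K : fieldType.
Local Notation T3 := {poly {poly {poly K}}}.
Implicit Types q g : T3.

Definition size_u q := sizeY (map_poly swapXY q).

(* The sum of the three partial degrees, not the total degree. *)
Definition tdeg q := ((size q).-1 + (sizeY q).-1 + (size_u q).-1)%N.

Lemma map_swapXY_eq0 q : (map_poly swapXY q == 0) = (q == 0).
Proof.
apply/eqP/eqP => [E|->]; last by rewrite raddf0.
apply/polyP => i; rewrite coef0; apply/eqP; rewrite -swapXY_eq0.
by rewrite -coef_map E coef0.
Qed.

Lemma tdegM q g : q != 0 -> g != 0 -> tdeg (q * g) = (tdeg q + tdeg g)%N.
Proof.
have pred2 (R : idomainType) (p r : {poly R}) : p != 0 -> r != 0 ->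
    (size (p * r)%R).-1 = ((size p).-1 + (size r).-1)%N.
  move=> p0 r0; rewrite size_mul //; move: p0 r0; rewrite -!size_poly_gt0.
  by move: (size _) (size _) => x y; lia.
move=> q0 g0; rewrite /tdeg /size_u rmorphM !sizeYE !rmorphM.
by rewrite !pred2 ?swapXY_eq0 ?map_swapXY_eq0 // [X in (X + _)%N]addnACA addnACA.
Qed.

Lemma tdeg_prod (s : seq T3) : (forall q, q \in s -> q != 0) ->
  tdeg (\prod_(q <- s) q) = (\sum_(q <- s) tdeg q)%N.
Proof.
elim: s => [|q s IH] s0.
  rewrite !big_nil /tdeg /size_u rmorph1 !sizeYE rmorph1 size_poly1 //.
have s0' r : r \in s -> r != 0 by move=> rs; apply: s0; rewrite in_cons rs orbT.
rewrite !big_cons tdegM ?IH //; first by apply: s0; rewrite mem_head.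
by rewrite prodf_seq_neq0; apply/allP => r /s0'.
Qed.

Lemma leq_size_tdeg q : (size q <= (tdeg q).+1)%N.
Proof. rewrite /tdeg; move: (size q) => m; lia. Qed.

Lemma leq_sizeY_tdeg q : (sizeY q <= (tdeg q).+1)%N.
Proof. rewrite /tdeg; lia. Qed.

Lemma size_coef2 q k j : (size (q`_k`_j)%R <= size_u q)%N.
Proof.
apply: leq_trans (max_size_coefXY _ k); rewrite coef_map /= -sizeYE.
exact: max_size_coefXY.
Qed.

Lemma size_ev_y a b d q : (size (ev_y a b d q) <= (tdeg q).+1)%N.
Proof.
have [->|q0] := eqVneq q 0; first by rewrite raddf0 size_poly0.
have sq : (0 < size q)%N by rewrite size_poly_gt0.
have lin : (size (a *: 'X + b%:P)%R <= 2)%N.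
  apply: leq_trans (size_polyD _ _) _; rewrite geq_max.
  rewrite (leq_trans (size_scale_leq _ _)) ?size_polyX //.
  by rewrite (leq_trans (size_polyC_leq1 _)).
rewrite ev_yE horner_coef; apply: leq_trans (size_sum _ _ _) _.
apply/bigmax_leqP => i _; apply: leq_trans (size_polyMleq _ _) _.
have s1 : (size ((a *: 'X + b%:P) ^+ i)%R <= i.+1)%N.
  by apply: leq_trans (size_poly_exp_leq _ _) _; move: lin; move: (size _) => m; nia.
have s2 : (size ((map_poly (horner_eval d%:P) q)`_i)%R <= (size_u q).-1.+1)%N.
  rewrite coef_map /= /horner_eval horner_coef; apply: leq_trans (size_sum _ _ _) _.
  apply/bigmax_leqP => j _; rewrite -rmorphXn mulrC mul_polyC.
  apply: leq_trans (size_scale_leq _ _) _; apply: leq_trans (size_coef2 _ _ _) _.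
  exact: leqSpred.
have s3 : (i < size q)%N by apply: leq_trans (ltn_ord i) (size_poly _ _).
have aux m n k x y z : (m <= k.+1 -> n <= z.-1.+1 -> k < x ->
  (n + m).-1 <= (x.-1 + y.-1 + z.-1).+1)%N by lia.
exact: aux s1 s2 s3.
Qed.

(* No condition on the degree in u. *)
Definition in_box n q := (size q <= n.+1)%N && (sizeY q <= n.+1)%N.

Lemma in_box_tdeg q : in_box (tdeg q) q.
Proof. by rewrite /in_box leq_size_tdeg leq_sizeY_tdeg. Qed.

Lemma in_boxW m n q : (m <= n)%N -> in_box m q -> in_box n q.
Proof.
by move=> mn /andP[s1 s2]; rewrite /in_box (leq_trans s1) // (leq_trans s2).
Qed.

Lemma in_boxM m n q g : in_box m q -> in_box n g -> in_box (m + n) (q * g).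
Proof.
rewrite /in_box !sizeYE rmorphM => /andP[s1 s2] /andP[s3 s4]; apply/andP.
split; apply: leq_trans (size_polyMleq _ _) _.
  by move: s1 s3; move: (size _) (size _) => x y; lia.
by move: s2 s4; move: (size _) (size _) => x y; lia.
Qed.

Lemma in_boxD n q g : in_box n q -> in_box n g -> in_box n (q + g).
Proof.
rewrite /in_box !sizeYE rmorphD => /andP[s1 s2] /andP[s3 s4]; apply/andP.
by split; apply: leq_trans (size_polyD _ _) _; rewrite geq_max ?s1 ?s2.
Qed.

Lemma in_boxN n q : in_box n q -> in_box n (- q).
Proof.
move=> /andP[s1 s2]; rewrite /in_box size_polyN s1 /=.
by apply: leq_sizeY => k; rewrite coefN size_polyN (leq_trans (max_size_coefXY _ _)).
Qed.

Lemma size_mulrn_leq (R : nzRingType) (p : {poly R}) n : (size (p *+ n)%R <= size p)%N.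
Proof. by rewrite -scaler_nat size_scale_leq. Qed.

Lemma in_box_deriv n q : in_box n q -> in_box n q^`().
Proof.
have [->|q0] := eqVneq q 0; first by rewrite deriv0.
move=> /andP[s1 s2]; apply/andP; split.
  exact: leq_trans (ltnW (lt_size_deriv q0)) s1.
apply: leq_sizeY => k; rewrite coef_deriv; apply: leq_trans s2.
exact: leq_trans (size_mulrn_leq _ _) (max_size_coefXY _ _).
Qed.

Lemma in_box_der_u n q : in_box n q -> in_box n (der_u q).
Proof.
move=> /andP[s1 s2]; apply/andP; split.
  exact: leq_trans (size_poly _ _) s1.
apply: leq_sizeY => k; rewrite coef_map; apply: leq_trans s2.
exact: leq_trans (size_poly _ _) (max_size_coefXY _ _).
Qed.

(** Each term of [flec] is a product of three derivatives of [q]. *)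
Lemma in_box_flec n q : in_box n q -> in_box (3 * n) (flec q).
Proof.
move=> bq; have bv := in_box_deriv bq; have bu := in_box_der_u bq.
have -> : (3 * n = n + n + n)%N by lia.
rewrite /flec !expr2 mulr2n; apply: in_boxD; first apply: in_boxD.
- exact: in_boxM (in_boxM bv bv) (in_box_der_u bu).
- have b3 := in_boxM (in_boxM bu bv) (in_box_deriv bu).
  by apply/in_boxN/in_boxD.
- exact: in_boxM (in_boxM bu bu) (in_box_deriv bv).
Qed.

Lemma tdeg_deriv q : (tdeg q^`() <= tdeg q)%N.
Proof.
have [->|q0] := eqVneq q 0; first by rewrite deriv0.
have sY (p : T3) : (sizeY p^`() <= sizeY p)%N.
  apply: leq_sizeY => k; rewrite coef_deriv.
  exact: leq_trans (size_mulrn_leq _ _) (max_size_coefXY _ _).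
have su : (size_u q^`() <= size_u q)%N by rewrite /size_u -deriv_map.
by rewrite /tdeg !leq_add // -!subn1 leq_sub2r // ltnW ?lt_size_deriv.
Qed.

(* Vanishes at a point when the horizontal line through it that is tangent to q = 0
   meets the line v = b, w = c u + d. *)
Definition director b c d q : T3 :=
  der_u q * ('X - (c *: 'X + d%:P)%:P)%:P - c%:P%:P%:P * ('X - b%:P%:P%:P) * q^`().

(** On a y-line inside q = 0 one has q_u = - a' q_v. The terms in u cancel, and the remaining
    constant vanishes exactly when the two lines meet. *)
Lemma ev_y_director b c d q a' b' d' : ev_y a' b' d' q = 0 ->
  ev_y a' b' d' (director b c d q) =
  ev_y a' b' d' q^`() * (c * (b - b') - a' * (d' - d))%:P.
Proof.
move=> q0; have : ev_y a' b' d' (der_u q) = - (a'%:P * ev_y a' b' d' q^`()).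
  by apply/eqP; rewrite -addr_eq0 -deriv_ev_y q0 deriv0.
have eC (p : {poly {poly K}}) : ev_y a' b' d' p%:P = p.[d'%:P].
  by rewrite ev_yE map_polyC hornerC.
have eX : ev_y a' b' d' 'X = a' *: 'X + b'%:P by rewrite ev_yE map_polyX hornerX.
have morph (R S : comNzRingType) (f : {rmorphism R -> S}) p h k x y r :
    f (p * h - k * (x - y) * r) = f p * f h - f k * (f x - f y) * f r.
  by rewrite rmorphB !rmorphM rmorphB.
move=> uE; rewrite /director.
rewrite [LHS](morph _ _ (ev_y a' b' d' : {rmorphism T3 -> {poly K}})) /=.
rewrite uE eX (eC b%:P%:P) (eC c%:P%:P) (eC ('X - _)) !hornerC.
rewrite hornerD hornerN hornerC hornerX polyCB !polyCM !polyCB -!mul_polyC.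
by move: (ev_y _ _ _ _) 'X => y x; ring.
Qed.

Lemma in_box_director b c d n q : in_box n q -> in_box n.+1 (director b c d q).
Proof.
move=> bq; have bv := in_box_deriv bq; have bu := in_box_der_u bq.
have bC (p : {poly {poly K}}) m : (size p <= m.+1)%N -> in_box m p%:P.
  move=> sp; rewrite /in_box (leq_trans (size_polyC_leq1 _)) //=.
  by apply: leq_sizeY => k; rewrite coefC; case: eqP; rewrite ?size_poly0.
rewrite /director -addn1; apply/in_boxD; first apply: in_boxM => //.
  by apply: bC; rewrite size_XsubC.
apply: in_boxN; rewrite addnC -[1%N]add0n; apply: in_boxM => //; apply: in_boxM.
  by apply: bC; rewrite size_polyC_leq1.
rewrite /in_box size_XsubC /=; apply: leq_sizeY => k.
have -> : ('X - b%:P%:P%:P)`_k = if k == 0%N then (- b%:P)%:P else (k == 1%N)%:R%:P :> {poly {poly K}}.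
  by rewrite coefB coefX coefC polyC_natr; case: k => [|k] /=; rewrite ?sub0r ?subr0 ?polyCN.
by case: ifP => _; apply: leqW; apply: size_polyC_leq1.
Qed.

End Degrees.

(** * Interpolation *)

Lemma underdetermined_system (K : fieldType) (T T' : finType) (f : T -> T' -> K) :
  (#|T'| < #|T|)%N ->
  exists2 g : T -> K, (exists t, g t != 0) & forall t', \sum_t g t * f t t' = 0.
Proof.
move=> ltT; pose A := \matrix_(i < #|T|, j < #|T'|) f (enum_val i) (enum_val j).
have kA : kermx A != 0.
  by rewrite -mxrank_eq0 mxrank_ker subn_eq0 -ltnNge (leq_ltn_trans (rank_leq_col _)).
pose v := nz_row (kermx A).
have v0 : v != 0 by rewrite nz_row_eq0.
have vA : v *m A = 0 by apply/sub_kermxP/nz_row_sub.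
exists (fun t => v 0 (enum_rank t)).
  case/rV0Pn: v0 => i vi; exists (enum_val i); by rewrite enum_valK.
move=> t'; move/matrixP/(_ 0 (enum_rank t')): vA; rewrite !mxE => {2}<-.
rewrite (reindex (@enum_val T T)) /=; last exact/onW_bij/enum_val_bij.
by apply: eq_bigr => i _; rewrite mxE enum_valK enum_rankK.
Qed.

Section Interpolation.
Variables (K : fieldType) (I : finType) (b c d : I -> K) (X : {set I}) (n : nat).
Local Notation T3 := {poly {poly {poly K}}}.
Local Notation exps := ('I_n * 'I_n * 'I_n)%type.

(** For [t = (i, j, k)] this is v^i w^j u^k. *)
Definition mon (t : exps) : T3 := ('X^(t.2) *: ('X^(t.1.2) : {poly {poly K}})) *: 'X^(t.1.1).

Definition mon_comb (g : exps -> K) : T3 := \sum_t (g t)%:P%:P *: mon t.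

Lemma coef_mon t i j k :
  (mon t)`_i`_j`_k = ((i == t.1.1) && (j == t.1.2) && (k == t.2))%:R.
Proof.
rewrite /mon coefZ coefXn; case: (i == _); last by rewrite mulr0 !coef0.
rewrite mulr1 coefZ coefXn; case: (j == _); last by rewrite mulr0 !coef0.
by rewrite mulr1 coefXn.
Qed.

Lemma coef_mon_comb g i j k :
  (mon_comb g)`_i`_j`_k = \sum_t g t * ((i == t.1.1) && (j == t.1.2) && (k == t.2))%:R.
Proof.
rewrite /mon_comb !coef_sum; apply: eq_bigr => t _.
by rewrite coefZ !coefCM coef_mon.
Qed.

Lemma coef_mon_comb_ord g (t : exps) : (mon_comb g)`_(t.1.1)`_(t.1.2)`_(t.2) = g t.
Proof.
rewrite coef_mon_comb (bigD1 t) //= !eqxx mulr1 big1 ?addr0 // => -[[i j] k] /= nt.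
case: t nt => -[i' j'] k' /= nt; case: andP; rewrite ?mulr0 // => -[/andP[/eqP e1 /eqP e2] /eqP e3].
by case/eqP: nt; congr (_, _, _); apply/val_inj.
Qed.

Lemma tdeg_mon_comb g : (tdeg (mon_comb g) <= 3 * n)%N.
Proof.
have c0 i j k : [|| n <= i, n <= j | n <= k]%N -> (mon_comb g)`_i`_j`_k = 0.
  move=> h; rewrite coef_mon_comb big1 // => -[[i' j'] k'] _ /=.
  case: andP; rewrite ?mulr0 // => -[/andP[/eqP e1 /eqP e2] /eqP e3].
  by move: h; rewrite e1 e2 e3 => /or3P[]; rewrite leqNgt ltn_ord.
have s1 : (size (mon_comb g) <= n)%N.
  apply/leq_sizeP => i hi; apply/polyP => j; apply/polyP => k.
  by rewrite c0 ?hi ?coef0.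
have s2 : (sizeY (mon_comb g) <= n)%N.
  apply: leq_sizeY => i; apply/leq_sizeP => j hj; apply/polyP => k.
  by rewrite c0 ?hj ?orbT ?coef0.
have s3 : (size_u (mon_comb g) <= n)%N.
  apply: leq_sizeY => i; rewrite coef_map /= -sizeYE; apply: leq_sizeY => j.
  by apply/leq_sizeP => k hk; rewrite c0 ?hk ?orbT.
rewrite /tdeg; move: s1 s2 s3; move: (size _) (sizeY _) (size_u _) => x y z; lia.
Qed.

Definition ev_mon (t : exps) (i : I) : {poly K} :=
  (b i ^+ t.1.1) *: ('X^(t.2) * (c i *: 'X + (d i)%:P) ^+ t.1.2).

Lemma ev_x_mon_comb g i :
  ev_x (b i) (c i) (d i) (mon_comb g) = \sum_t g t *: ev_mon t i.
Proof.
rewrite ev_xE /mon_comb !horner_sum; apply: eq_bigr => t _.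
rewrite /mon !hornerZ !hornerXn -!polyC_exp !hornerM !hornerC hornerZ hornerXn.
by rewrite /ev_mon -!mul_polyC; ring.
Qed.

Lemma size_ev_mon t i : (size (ev_mon t i) <= 2 * n)%N.
Proof.
apply: leq_trans (size_scale_leq _ _) _; apply: leq_trans (size_polyMleq _ _) _.
have lin : (size (c i *: 'X + (d i)%:P)%R <= 2)%N.
  apply: leq_trans (size_polyD _ _) _; rewrite geq_max.
  rewrite (leq_trans (size_scale_leq _ _)) ?size_polyX //.
  by rewrite (leq_trans (size_polyC_leq1 _)).
have := size_poly_exp_leq (c i *: 'X + (d i)%:P) t.1.2.
rewrite size_polyXn; case: t => -[i' [j hj]] [k hk] /=.
move: lin; move: (size _) (size _) => x y; nia.
Qed.

Hypothesis X_small : (#|X| * (2 * n) < n ^ 3)%N.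

(** Parameter count: [n ^ 3] coefficients against [2 * n] linear conditions per line, since the
    restrictions of the monomials have degree below [2 * n]. *)
Lemma vanishing_poly : exists Q : T3,
  [/\ Q != 0, (tdeg Q <= 3 * n)%N &
      forall i, i \in X -> ev_x (b i) (c i) (d i) Q = 0].
Proof.
pose f (t : exps) (t' : {i | i \in X} * 'I_(2 * n)) := (ev_mon t (val t'.1))`_(t'.2).
have [|g [t gt] gf] := @underdetermined_system K _ _ f.
  by rewrite !card_prod !card_ord card_sig; apply: leq_trans X_small _; lia.
exists (mon_comb g); split; last 1 first.
- move=> i iX; rewrite ev_x_mon_comb; apply/polyP => m; rewrite coef_sum coef0.
  have [mn|mn] := ltnP m (2 * n).
    rewrite -[RHS](gf (exist _ i iX, Ordinal mn)).
    by apply: eq_bigr => u _; rewrite coefZ.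
  rewrite big1 // => u _; rewrite coefZ nth_default ?mulr0 //.
  exact: leq_trans (size_ev_mon _ _) mn.
- by apply: contraNneq gt => E; rewrite -coef_mon_comb_ord E !coef0.
- exact: tdeg_mon_comb.
Qed.

End Interpolation.

(** * Ruled surfaces *)

Section Ruled.
Variables (K : fieldType) (n : nat).
Local Notation T3 := {poly {poly {poly K}}}.
Hypothesis K_inf : forall m, exists2 s : seq K, uniq s & size s = m.
Hypothesis char_K : forall m, (0 < m < n)%N -> m%:R != 0 :> K.
Implicit Types q : T3.

(** The degree in v is invertible in [K], so the leading term survives differentiation. *)
Lemma deriv_neq0 q : (1 < size q)%N -> (tdeg q < n)%N -> q^`() != 0.
Proof.
move=> s1 tq; have sq := leq_size_tdeg q.
apply/eqP => /(congr1 (fun p : T3 => p`_(size q).-2)); rewrite coef_deriv coef0.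
have -> : (size q).-2.+1 = (size q).-1 by case: (size q) s1 => [|[]].
have m0 : ((size q).-1)%:R != 0 :> {poly {poly K}}.
  rewrite -!polyC_natr !polyC_eq0; apply: char_K.
  by move: s1 tq sq; move: (size q) => m; lia.
apply/eqP; rewrite -mulr_natr mulf_neq0 // -/(lead_coef q) lead_coef_eq0.
by rewrite -size_poly_gt0 ltnW.
Qed.

Lemma ndvd_deriv q : (1 < size q)%N -> (tdeg q < n)%N -> ~ rdvd q q^`().
Proof.
move=> s1 tq [g E]; have q'0 := deriv_neq0 s1 tq.
have q0 : q != 0 by rewrite -size_poly_gt0 ltnW.
have g0 : g != 0 by apply: contraNneq q'0 => g0; rewrite E g0 mul0r.
have := lt_size_deriv q0; rewrite E size_mul //; move: g0; rewrite -size_poly_gt0.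
by move: (size _) (size _) => x y; lia.
Qed.

(** By the choice of slope the restriction of [q] has a double zero at [u]. As [q] divides [flec q],
    [ev_y_flec] becomes a second-order differential equation, to which [order2_vanish] applies. *)
Lemma ev_y_tangent q u v w : (tdeg q < n)%N -> rdvd q (flec q) ->
  ev_pt u v w q = 0 -> ev_pt u v w q^`() != 0 ->
  let a := - (ev_pt u v w (der_u q) / ev_pt u v w q^`()) in
  ev_y a (v - a * u) w q = 0.
Proof.
move=> tq [g flecE] q0 q'0 a; have vE : a * u + (v - a * u) = v by ring.
have [G] := ev_y_flec a (v - a * u) w q.
rewrite flecE rmorphM => E.
apply: (order2_vanish (x := u) (psi := ev_y a (v - a * u) w q^`())
  (s := ev_y a (v - a * u) w g) (g := G) char_K).
- exact: leq_trans (size_ev_y _ _ _ _) tq.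
- by rewrite ev_y_pt vE.
- by rewrite ev_y_pt vE.
- rewrite deriv_ev_y hornerD hornerM hornerC !ev_y_pt vE /a.
  by rewrite mulNr divfK // subrr.
- by apply/eqP; rewrite -subr_eq -E mulrC.
Qed.

(* The horizontal tangents at the points of the x-line are contained in q = 0, so
   [q] and [director] vanish on infinitely many common lines. *)
Lemma rdvd_director q b c d : rprime q -> (tdeg q < n)%N -> rdvd q (flec q) ->
  c != 0 -> ev_x b c d q = 0 -> ev_x b c d q^`() != 0 -> rdvd q (director b c d q).
Proof.
move=> pq tq fq c0 q0 q'0; apply: contrapT => ndir.
set D := (tdeg q).+1; set psi := ev_x b c d q^`() in q'0.
(* Enough parameters to exceed the Bezout bound after discarding the roots of [psi], where the
   tangent is not defined. [D] bounds the degrees of both [q] and its director. *)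
have [s us ss] := K_inf ((D + D) * D + size psi).
pose s' := [seq x <- s | ~~ root psi x].
have : (count (root psi) s < size psi)%N.
  rewrite -size_filter; apply: max_poly_roots => //.
    by apply/allP => x; rewrite mem_filter => /andP[].
  by rewrite filter_uniq.
have := count_predC (root psi) s; rewrite ss -[count (predC _) s]size_filter -/s' => cE cR.
have us' : uniq s' by rewrite filter_uniq.
pose u (j : 'I_(size s')) := nth 0 s' j.
have u_inj : injective u by move=> i j /eqP; rewrite nth_uniq // => /eqP /val_inj.
have uP j : psi.[u j] != 0.
  by have := mem_nth 0 (ltn_ord j); rewrite mem_filter => /andP[].
pose w j := c * u j + d.
pose a j := - (ev_pt (u j) b (w j) (der_u q) / ev_pt (u j) b (w j) q^`()).
have w_inj : injective w by move=> i j /addIr /(mulfI c0) /u_inj.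
have sq : (1 < size q)%N.
  rewrite ltnNge; apply/negP => sq; case/eqP: q'0.
  by rewrite /psi (size1_polyC sq) derivC raddf0.
have /andP[q1 q2] := in_boxW (leqnSn _) (in_box_tdeg q).
have /andP[d1 d2] := in_box_director b c d (in_box_tdeg q).
have on_q j : ev_y (a j) (b - a j * u j) (w j) q = 0.
  apply: ev_y_tangent => //; first by rewrite -ev_x_pt q0 horner0.
  by rewrite -ev_x_pt.
have : (#|[set: 'I_(size s')]| <= (D + D) * D)%N.
  apply: (bezout_lines (a := a) (b := fun j => b - a j * u j) w_inj
    pq sq ndir q1 d1 q2 d2) => j _; split=> //; rewrite ev_y_director //.
  (* The tangent passes through its point of contact, which lies on the x-line. *)
  suff -> : c * (b - (b - a j * u j)) - a j * (w j - d) = 0 by rewrite polyC0 mulr0.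
  by rewrite /w; ring.
rewrite cardsT card_ord leqNgt => /negP[]; move: cE cR.
by move: (size psi) (size s') (count _ _) => x y z; lia.
Qed.

(** If v did not occur, vanishing on the y-line would make w - d' a multiple of [q]. The x-line
    would then lie in a plane of constant w, which [c != 0] excludes. *)
Lemma rprime_lines_size_gt1 q b c d a' b' d' : rprime q -> c != 0 ->
  ev_x b c d q = 0 -> ev_y a' b' d' q = 0 -> (1 < size q)%N.
Proof.
move=> [q0 _ pq] c0 qx qy; rewrite ltnNge; apply/negP => sq.
have [r rE] : exists r, q = r%:P by exists q`_0; apply: size1_polyC.
have r0 : r != 0 by rewrite -polyC_eq0 -rE.
have /factor_theorem[t tE] : root r d'%:P.
  by apply/eqP; move: qy; rewrite rE ev_yE map_polyC hornerC.
have t0 : t != 0 by apply: contraNneq r0 => t0; rewrite tE t0 mul0r.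
case: (pq (t%:P : T3) (('X - d'%:P%:P : {poly {poly K}})%:P : T3)); first by exists 1; rewrite mul1r -polyCM -tE.
  case=> g; rewrite rE => /(congr1 (fun p : T3 => p`_0)); rewrite coefC coefMC /= => tg.
  have g0 : g`_0 != 0 by apply: contraNneq t0 => g0; rewrite tg g0 mul0r.
  have := congr1 (fun p : {poly {poly K}} => size p) tg.
  rewrite size_mul // tE size_mul ?polyXsubC_eq0 // size_XsubC.
  by move: t0 g0; rewrite -!size_poly_gt0; move: (size _) (size _) => x y; lia.
case=> g /(congr1 (ev_x b c d)); rewrite [RHS]rmorphM /= qx mulr0 ev_xE hornerC hornerD hornerX hornerN hornerC.
move/(congr1 (fun p : {poly K} => p`_1)); rewrite !(coefB, coefD, coefZ, coefX, coefC) /= mulr1 addr0 subr0.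
by move/eqP: c0.
Qed.

End Ruled.

(** * Incidences between lines *)

Lemma leq_card_bigcup (I T : finType) (F : I -> {set T}) :
  (#|\bigcup_i F i| <= \sum_i #|F i|)%N.
Proof.
elim/big_ind2: _ => [|A m A' m' hA hA'|//]; first by rewrite cards0.
by apply: leq_trans (leq_card_setU _ _) _; rewrite leq_add.
Qed.

Lemma sum_sqr_leq (T : Type) (s : seq T) (f : T -> nat) :
  (\sum_(x <- s) f x ^ 2 <= (\sum_(x <- s) f x) ^ 2)%N.
Proof.
elim: s => [|x s IH]; rewrite ?big_nil // !big_cons.
by move: IH; move: (\sum_(_ <- _) _)%N (\sum_(_ <- _) _)%N (f x) => a b c; nia.
Qed.

Section LineIncidences.
Variables (K : fieldType) (I J : finType).
Variables (xb xc xd : I -> K) (ya yb yd : J -> K) (k : nat).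
Local Notation T3 := {poly {poly {poly K}}}.

(** The only candidate for a common point has u = ([xb i] - [yb j]) / [ya j]; the equality of the
    w-coordinates there is multiplied by [ya j]. *)
Definition meets i j := xc i * (xb i - yb j) == ya j * (yd j - xd i).

Definition incidences (X : {set I}) (Y : {set J}) :=
  (\sum_(i in X) #|[set j in Y | meets i j]|)%N.

Hypothesis K_inf : forall m, exists2 s : seq K, uniq s & size s = m.
Hypotheses (xb_inj : injective xb) (yd_inj : injective yd).
Hypotheses (xc_neq0 : forall i, xc i != 0) (ya_neq0 : forall j, ya j != 0).
Hypothesis few_common : forall i i', i != i' ->
  (#|[set j | meets i j && meets i' j]| <= k)%N.

Local Notation evx i := (ev_x (xb i) (xc i) (xd i)).
Local Notation evy j := (ev_y (ya j) (yb j) (yd j)).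
Let u i j := (xb i - yb j) / ya j.

Lemma meets_ev i j (g : T3) : meets i j -> (evx i g).[u i j] = (evy j g).[u i j].
Proof.
move=> /eqP ij; rewrite ev_x_pt ev_y_pt; congr ev_pt.
  by rewrite /u mulrC divfK ?subrK.
by rewrite /u mulrA ij mulrAC mulfV // mul1r subrK.
Qed.

Lemma u_inj j : injective (u ^~ j).
Proof.
move=> i i' /(mulIf _) h; apply: xb_inj; apply: (addIr (- yb j)); apply: h.
by rewrite invr_eq0.
Qed.

(* [B] consists of the lines contained in a component that is not ruled by
   horizontal lines, or along which the v-derivative of a component vanishes. *)
Lemma line_incidence_step (X : {set I}) (Y : {set J}) n :
  (forall m, (0 < m <= 3 * n)%N -> m%:R != 0 :> K) ->
  (#|X| * (2 * n) < n ^ 3)%N ->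
  exists B : {set J}, [/\ B \subset Y, (#|B| <= 108 * n ^ 2)%N &
    (incidences X (Y :\: B) <= 9 * n * #|Y| + k * #|X|)%N].
Proof.
move=> char_K X_small.
have {}char_K m : (0 < m < (3 * n).+1)%N -> m%:R != 0 :> K by rewrite ltnS; apply: char_K.
have [Q [Q0 tQ QX]] := vanishing_poly xb xc xd X_small.
have := factorial_domain_poly (factorial_domain_poly (factorial_domain_poly (@factorial_domain_field K))).
move=> /(_ Q Q0)[e [qs [ue qsP QE]]].
have e0 : e != 0 by apply: contraTneq ue => ->; rewrite unitr0.
have qs0 q : q \in qs -> q != 0 by move=> /qsP[].
have prod0 : \prod_(q <- qs) q != 0.
  by rewrite prodf_seq_neq0; apply/allP => q /qs0.
have sum_tdeg : (\sum_(q <- qs) tdeg q <= 3 * n)%N.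
  by apply: leq_trans tQ; rewrite QE tdegM // tdeg_prod // leq_addl.
have tq q : q \in qs -> (tdeg q < (3 * n).+1)%N.
  move=> qqs; rewrite ltnS; apply: leq_trans sum_tdeg.
  by rewrite (big_rem q) //= leq_addr.
have comp i : i \in X -> has (fun q => evx i q == 0) qs.
  move=> iX; have := QX i iX; rewrite QE rmorphM rmorph_prod /= => /eqP.
  rewrite mulf_eq0 prodf_seq_eq0 /= => /orP[/eqP ei|//].
  have [f fe] : exists f, e * f = 1 by exists e^-1; rewrite mulrV.
  have := congr1 (evx i) fe; rewrite rmorphM rmorph1 /= ei mul0r => /esym/eqP.
  by rewrite oner_eq0.
pose q_ (l : nat) : T3 := nth 0 qs l.
(* The first factor containing the x-line [i]. The additional index [size qs] makes [inord]
   available and stands for the default polynomial 0. *)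
pose lx i : 'I_(size qs).+1 := inord (find (fun q => evx i q == 0) qs).
have lxP i : i \in X -> q_ (lx i) \in qs /\ evx i (q_ (lx i)) = 0.
  move=> /comp hi; rewrite /q_ /lx inordK ?ltnS ?find_size //.
  by rewrite mem_nth -?has_find //; split=> //; apply/eqP/(nth_find 0 hi).
have prime_l (l : nat) : (1 < size (q_ l))%N -> q_ l \in qs.
  move=> s1; apply: mem_nth; rewrite ltnNge; apply/negP => hl.
  by move: s1; rewrite /q_ nth_default // size_poly0.
have sum_q (f : T3 -> nat) : f 0 = 0%N ->
    (\sum_(l < (size qs).+1) f (q_ l) = \sum_(q <- qs) f q)%N.
  move=> f0; rewrite big_ord_recr /= /q_ nth_default // f0 addn0.
  by rewrite [RHS](big_nth 0) big_mkord.
pose bad (l : nat) j := `[< [/\ (1 < size (q_ l))%N, evy j (q_ l) = 0 &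
   ~ rdvd (q_ l) (flec (q_ l)) \/ evy j (q_ l)^`() = 0] >].
(* Bezout against the v-derivative gives at most 2 t^2 lines for t = [tdeg (q_ l)], and against
   [flec] at most (t + 3t) 3t = 12 t^2. Since the t sum to at most [3 * n], the total is
   [108 * n ^ 2]. *)
have bad_card l : (#|[set j | bad l j]| <= 12 * tdeg (q_ l) ^ 2)%N.
  have [s1|s1] := leqP (size (q_ l)) 1.
    rewrite eq_card0 // => j; rewrite !inE; apply/negP => /asboolP[].
    by rewrite ltnNge s1.
  have lq := prime_l _ s1; have tl := tq _ lq.
  have /andP[b1 b2] := in_box_tdeg (q_ l).
  have [fl|nfl] := pselect (rdvd (q_ l) (flec (q_ l))).
    have /andP[d1 d2] := in_box_deriv (in_box_tdeg (q_ l)).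
    apply: leq_trans (bezout_lines (a := ya) (b := yb) yd_inj (qsP _ lq) s1 (ndvd_deriv char_K s1 tl) b1 d1 b2 d2 _) _.
      by move=> j; rewrite inE => /asboolP[_ qj [nf|q'j]]; [case: nf|].
    nia.
  have /andP[d1 d2] := in_box_flec (in_box_tdeg (q_ l)).
  have b3 : (sizeY (q_ l) <= (3 * tdeg (q_ l)).+1)%N by apply: leq_trans b2 _; lia.
  apply: leq_trans (bezout_lines (a := ya) (b := yb) yd_inj (qsP _ lq) s1 nfl b1 d1 b3 d2 _) _.
    move=> j; rewrite inE => /asboolP[_ qj _]; split=> //.
    by have [g ->] := ev_y_flec (ya j) (yb j) (yd j) (q_ l); rewrite qj !deriv0 mulr0 mul0r subr0.
  nia.
pose B := [set j in Y | [exists l : 'I_(size qs).+1, bad l j]].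
exists B; split; first by apply/subsetP => j; rewrite inE => /andP[].
  apply: (@leq_trans #|\bigcup_(l < (size qs).+1) [set j | bad l j]|).
    apply/subset_leq_card/subsetP => j; rewrite inE => /andP[_ /existsP[l bl]].
    by apply/bigcupP; exists l; rewrite ?inE.
  apply: leq_trans (leq_card_bigcup _) _.
  apply: (@leq_trans (\sum_(l < (size qs).+1) 12 * tdeg (q_ l) ^ 2)%N).
    by apply: leq_sum => l _; apply: bad_card.
  rewrite (sum_q (fun q => 12 * tdeg q ^ 2)%N) -?big_distrr /=; last first.
    by rewrite /tdeg /size_u raddf0 !sizeYE raddf0 size_poly0.
  apply: leq_trans (leq_mul (leqnn 12) (sum_sqr_leq _ _)) _.
  by move: sum_tdeg; move: (\sum_(q <- qs) _)%N => x; nia.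
(* Restrictions that vanish identically are replaced by 1, so [Z j] is nonzero. Its roots include
   every parameter where the y-line crosses a factor, or the zero set of its v-derivative, without
   being contained in it. *)
pose z1 j q := if evy j q == 0 then 1 else evy j q.
pose Z j := \prod_(q <- qs) (z1 j q * z1 j q^`()).
have z1_0 j q : z1 j q != 0 by rewrite /z1; case: ifPn => // _; apply: oner_neq0.
have Z0 j : Z j != 0 by rewrite prodf_seq_neq0; apply/allP => q _; rewrite mulf_neq0.
have size_z1 j q : (size (z1 j q) <= (tdeg q).+1)%N.
  by rewrite /z1; case: ifP => _; rewrite ?size_poly1 ?size_ev_y.
have size_Z j : (size (Z j) <= (6 * n).+1)%N.
  have : (size (Z j) <= (2 * \sum_(q <- qs) tdeg q).+1)%N.
    rewrite /Z; elim: (qs) => [|q s IH]; rewrite ?big_nil ?size_poly1 // !big_cons.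
    apply: leq_trans (size_polyMleq _ _) _.
    have aux a b c r t v : (a <= t.+1 -> b <= t.+1 -> c <= (a + b).-1 ->
      r <= (2 * v).+1 -> (c + r).-1 <= (2 * (t + v)).+1)%N by lia.
    apply: (aux (size (z1 j q)) (size (z1 j q^`()))); rewrite ?size_polyMleq //.
    by apply: leq_trans (size_z1 _ _) _; rewrite ltnS tdeg_deriv.
  move=> sZ; apply: leq_trans sZ _; rewrite ltnS -(mulnA 2 3 n).
  by rewrite leq_mul2l.
have rootZ j q x : q \in qs -> root (z1 j q) x || root (z1 j q^`()) x -> root (Z j) x.
  move=> qqs r; rewrite /Z (big_rem q) //= rootM; apply/orP; left; by rewrite rootM.
(* [G i]: the chosen factor through the x-line [i] is ruled and its v-derivative is not identically
   zero on that line. [good i j]: moreover, the y-line [j] lies in that factor. *)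
pose G i := [&& (1 < size (q_ (lx i)))%N, `[< rdvd (q_ (lx i)) (flec (q_ (lx i))) >] &
  evx i (q_ (lx i))^`() != 0].
pose good i j := G i && (evy j (q_ (lx i)) == 0).
have not_bad j l : j \in Y :\: B -> (1 < size (q_ l))%N -> evy j (q_ l) = 0 ->
    rdvd (q_ l) (flec (q_ l)) /\ evy j (q_ l)^`() != 0.
  rewrite !inE => /andP[nB jY] s1 qj; rewrite jY /= in nB.
  have ls : (l < (size qs).+1)%N.
    by rewrite ltnNge; apply/negP => hl; move: s1; rewrite /q_ nth_default ?size_poly0 // ltnW.
  move/existsPn/(_ (Ordinal ls))/asboolP: nB => /= nb.
  split; first by apply: contrapT => nf; apply: nb; split=> //; left.
  by apply/eqP => q'j; apply: nb; split=> //; right.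
(* At the meeting point the chosen factor vanishes. If it is not identically zero on the y-line this
   gives a root of [Z j]; otherwise the pair is [good], or the v-derivative vanishes along the
   x-line and gives the root. *)
have dichotomy i j : i \in X -> j \in Y :\: B -> meets i j ->
    good i j || root (Z j) (u i j).
  move=> iX jY ij; have [lq qi] := lxP i iX.
  have [qj|qj] := eqVneq (evy j (q_ (lx i))) 0; last first.
    rewrite orbC (rootZ _ _ _ lq) // /z1 (negPf qj) /root -meets_ev // qi.
    by rewrite horner0 eqxx.
  have s1 := rprime_lines_size_gt1 (qsP _ lq) (xc_neq0 i) qi qj.
  have [fl q'j] := not_bad _ _ jY s1 qj.
  have [q'i|q'i] := eqVneq (evx i (q_ (lx i))^`()) 0; last first.
    by rewrite /good /G s1 q'i qj eqxx !andbT; apply/orP; left; apply/asboolP.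
  rewrite orbC (rootZ _ _ _ lq) // /z1 (negPf q'j) /root -meets_ev // q'i.
  by rewrite horner0 eqxx orbT.
(* The director vanishes on the y-line, where it is the nonzero v-derivative times the meeting
   condition. *)
have good_meets i j : i \in X -> j \in Y :\: B -> good i j -> meets i j.
  move=> iX jY /andP[/and3P[s1 /asboolP fl q'i] /eqP qj].
  have [lq qi] := lxP i iX.
  have [_ q'j] := not_bad _ _ jY s1 qj.
  have [g dE] := rdvd_director K_inf char_K (qsP _ lq) (tq _ lq) fl (xc_neq0 i) qi q'i.
  have := ev_y_director (xb i) (xc i) (xd i) qj; rewrite dE rmorphM /= qj mulr0.
  move/esym/eqP; rewrite mulf_eq0 (negPf q'j) /= polyC_eq0 subr_eq0 /meets.
  by [].
pose Yi i := [set j in Y :\: B | good i j].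
have YiE i j : (j \in Yi i) = (j \in Y :\: B) && good i j by rewrite [LHS]inE.
(* If two lines with [G] share a factor, all its remaining y-lines meet both, so [k] bounds their
   number. Only a line alone in its factor requires the trivial bound [#|Y|]. *)
pose lone i := [forall i' in X, (i' != i) ==> ~~ (G i' && (lx i' == lx i))].
have split_i i : i \in X ->
    (#|[set j in Y :\: B | meets i j]| <=
     #|[set j in Y | root (Z j) (u i j)]| + (k + (G i && lone i) * #|Y|))%N.
  move=> iX; apply: (@leq_trans (#|[set j in Y | root (Z j) (u i j)]| + #|Yi i|)%N).
    apply: leq_trans (leq_card_setU _ _); apply/subset_leq_card/subsetP => j.
    rewrite inE => /andP[jY ij]; have jY' := subsetP (subsetDl _ _) _ jY.
    by apply/setUP; case/orP: (dichotomy _ _ iX jY ij) => h; [right|left]; rewrite inE ?jY ?jY'.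
  rewrite leq_add2l; have [Gi|nG] := boolP (G i); last first.
    by rewrite eq_card0 // => j; rewrite YiE /good (negPf nG) andbF.
  have [lo|] := boolP (lone i); last first.
    case/forall_inPn => i' i'X; rewrite negb_imply negbK.
    move=> /andP[ne /andP[Gi' /eqP ll]]; rewrite eq_sym in ne.
    rewrite mul0n addn0; apply: leq_trans (few_common ne).
    apply/subset_leq_card/subsetP => j; rewrite YiE => /andP[jY gj].
    rewrite inE (good_meets _ _ iX jY gj) /=; apply: good_meets => //.
    by move: gj; rewrite /good Gi' Gi ll.
  rewrite mul1n (leq_trans _ (leq_addl _ _)) //.
  apply/subset_leq_card/subsetP => j; rewrite YiE => /andP[jY _].
  exact: (subsetP (subsetDl _ _) _ jY).
(* For fixed [j], distinct x-lines have distinct parameters [u i j], so the degree of [Z j] bounds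
   their number. *)
have count_roots : (\sum_(i in X) #|[set j in Y | root (Z j) (u i j)]| <= 6 * n * #|Y|)%N.
  under eq_bigr do rewrite -sum1dep_card.
  rewrite (exchange_big_dep (mem Y)) /=; last by move=> i j _ /andP[].
  rewrite mulnC -sum_nat_const; apply: leq_sum => j jY; rewrite sum1dep_card.
  rewrite -ltnS; apply: leq_trans (size_Z j).
  by apply: (card_roots_size (@u_inj j)) => // i; rewrite inE jY => /andP[].
(* Lone lines choose distinct factors, each of positive degree. With the roots this makes the
   coefficient 6 + 3 = 9. *)
have count_lone : (#|[set i in X | G i && lone i]| <= 3 * n)%N.
  set U := [set i in X | _].
  have lx_inj : {in U &, injective lx}.
    move=> i i'; rewrite !inE => /and3P[iX Gi /forall_inP li] /and3P[i'X Gi' _] ll.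
    apply/eqP/negPn/negP => ne; have := li i' i'X; rewrite eq_sym ne Gi' ll eqxx.
    by [].
  rewrite -(card_in_imset lx_inj) -sum1_card; apply: leq_trans sum_tdeg.
  rewrite -(sum_q (@tdeg K)); last by rewrite /tdeg /size_u raddf0 !sizeYE raddf0 size_poly0.
  rewrite [X in (_ <= X)%N](bigID (fun l => l \in lx @: U)) /=.
  apply: leq_trans (leq_addr _ _); apply: leq_sum => l /imsetP[i].
  rewrite inE => /and3P[iX /and3P[s1 _ _] _] ->.
  by rewrite /tdeg; move: s1; move: (size _); lia.
apply: leq_trans.
  by apply: leq_sum => i iX; apply: split_i iX.
rewrite big_split /= big_split /= -big_distrl /= sum_nat_const.
have -> : (\sum_(i in X) (G i && lone i) = #|[set i in X | G i && lone i]|)%N.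
  by rewrite -sum1dep_card big_mkcondr /=; apply: eq_bigr => i _; case: (_ && _).
move: count_roots count_lone.
move: (\sum_(i in X) _)%N #|[set i in X | _]| => x y; nia.
Qed.

End LineIncidences.

(** * Recursion on the exceptional lines *)

Lemma exists_subset_card (T : finType) (X : {set T}) m : (m <= #|X|)%N ->
  exists2 X1 : {set T}, X1 \subset X & #|X1| = m.
Proof.
move=> mX; exists [set x in take m (enum X)].
  by apply/subsetP => x; rewrite inE => /mem_take; rewrite mem_enum.
rewrite cardsE (card_uniqP _) ?take_uniq ?enum_uniq // size_take -cardE.
by rewrite ltn_neqAle mX andbT; case: eqP.
Qed.

(** Absorbs the logarithmic factor of the dyadic recursion; it is the sixth power of l <= 6 * 2^(l /
    6), with the quotient rounded down. *)
Lemma leq_poly_exp2 l : (l ^ 6 <= 6 ^ 6 * 2 ^ l)%N.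
Proof.
have h : (l <= 6 * 2 ^ (l %/ 6))%N.
  have := ltn_expl (l %/ 6)%N (isT : 1 < 2)%N.
  have := divn_eq l 6; have := ltn_pmod l (isT : 0 < 6)%N.
  by move: (l %/ 6)%N (l %% 6)%N => a b; move: (2 ^ a)%N => c; lia.
apply: (@leq_trans ((6 * 2 ^ (l %/ 6)) ^ 6)%N); first by rewrite leq_exp2r.
rewrite expnMn leq_pmul2l ?expn_gt0 // -expnM leq_exp2l //.
exact: leq_trunc_div.
Qed.

Section Recursion.
Variables (K : fieldType) (I J : finType).
Variables (xb xc xd : I -> K) (ya yb yd : J -> K) (k : nat).
Hypothesis K_inf : forall m, exists2 s : seq K, uniq s & size s = m.
Hypotheses (xb_inj : injective xb) (yd_inj : injective yd).
Hypotheses (xc_neq0 : forall i, xc i != 0) (ya_neq0 : forall j, ya j != 0).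
Local Notation touch := (meets xb xc xd ya yb yd).
Local Notation inc := (incidences xb xc xd ya yb yd).
Hypothesis few_common : forall i i', i != i' ->
  (#|[set j | touch i j && touch i' j]| <= k)%N.

Lemma incidencesD (X X1 : {set I}) Y : X1 \subset X ->
  inc X Y = (inc X1 Y + inc (X :\: X1) Y)%N.
Proof.
move=> sX; rewrite /incidences (big_setID X1) /=.
by have /setIidPr -> := sX.
Qed.

Lemma incidences_split (X : {set I}) Y N E m :
  (forall X' : {set I}, #|X'| <= N -> inc X' Y <= E)%N ->
  (#|X| <= m * N)%N -> (inc X Y <= m * E)%N.
Proof.
move=> small; elim: m X => [|m IH] X.
  by rewrite leqn0 cards_eq0 => /eqP ->; rewrite /incidences big_set0.
have [XN _|NX sX] := leqP #|X| N; first by apply: leq_trans (small _ XN) _; rewrite leq_pmull.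
have [X1 sX1 c1] := exists_subset_card (ltnW NX).
rewrite (incidencesD _ sX1) mulSn leq_add ?small ?c1 // IH //.
by rewrite cardsDS // c1 leq_subLR -mulSn.
Qed.

Lemma leq_incidencesD (X : {set I}) (Y B : {set J}) : B \subset Y ->
  (inc X Y <= inc X B + inc X (Y :\: B))%N.
Proof.
move=> sB; rewrite /incidences -big_split /=; apply: leq_sum => i _.
apply: leq_trans (leq_card_setU _ _); apply/subset_leq_card/subsetP => j.
by rewrite !inE => /andP[-> ->]; case: (j \in B).
Qed.

(* [line_incidence_step] is applied to the four parts of a partition of [X]; the
   exceptional set [B] of each part is again small enough for the induction. *)
Lemma incidences_dyadic C l (X : {set I}) (Y : {set J}) :
  (72 * 512 <= C)%N ->
  (forall m, (0 < m <= 3 * 2 ^ l)%N -> m%:R != 0 :> K) ->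
  (#|X| <= 4 ^ l)%N -> (#|Y| <= 512 * 4 ^ l)%N ->
  (inc X Y <= C * 8 ^ l + k * l * 4 ^ l)%N.
Proof.
move=> leC; elim: l X Y => [|l IH] X Y char_K cX cY.
  apply: (@leq_trans (#|X| * #|Y|)%N); last first.
    by move: leC cX cY; rewrite !expn0; move: #|X| #|Y| => x y; nia.
  rewrite /incidences -sum_nat_const; apply: leq_sum => i _.
  by apply/subset_leq_card/subsetP => j; rewrite inE => /andP[].
have char_l m : (0 < m <= 3 * 2 ^ l)%N -> m%:R != 0 :> K.
  by case/andP=> m0 ml; apply: char_K; rewrite m0 (leq_trans ml) // leq_mul // leq_pexp2l.
have {}IH X' Y' := IH X' Y' char_l.
have e8 : (8 ^ l = 4 ^ l * 2 ^ l)%N by rewrite -expnMn.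
set E := (C * 8 ^ l + k * l * 4 ^ l + (9 * 2 ^ l.+1 * #|Y| + k * 4 ^ l))%N.
(* With [n = 2 ^ l.+1] the exceptional set has at most 108 * 4 * 4^l = 432 * 4^l lines, within the
   512 * 4^l that the induction hypothesis allows. *)
have small (X' : {set I}) : (#|X'| <= 4 ^ l)%N -> (inc X' Y <= E)%N.
  move=> cX'; have [|B [sB cB iB]] := @line_incidence_step K I J xb xc xd ya yb yd k K_inf xb_inj
    yd_inj xc_neq0 ya_neq0 few_common X' Y (2 ^ l.+1) char_K.
    have p2 : (0 < 2 ^ l)%N by rewrite expn_gt0.
    have p4 : (0 < 4 ^ l)%N by rewrite expn_gt0.
    have -> : ((2 ^ l.+1) ^ 3 = 8 * (4 ^ l * 2 ^ l))%N.
      by rewrite -e8 -expnM mulnC expnM -expnS.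
    by move: cX' p2 p4; rewrite expnS; move: #|X'| (2 ^ l)%N (4 ^ l)%N => x a b; nia.
  apply: leq_trans (leq_incidencesD _ sB) _; apply: leq_add; last first.
    by apply: leq_trans iB _; rewrite leq_add2l leq_mul2l cX' orbT.
  apply: IH => //.
  apply: leq_trans cB _; have -> : ((2 ^ l.+1) ^ 2 = 4 * 4 ^ l)%N by rewrite -expnM mulnC expnM -expnS.
  by move: (4 ^ l)%N => a; lia.
have cX4 : (#|X| <= 4 * 4 ^ l)%N by rewrite -expnS.
apply: leq_trans (incidences_split small cX4) _.
rewrite /E !(expnS _ l) e8; rewrite expnS in cY.
move: leC cY; move: (4 ^ l)%N (2 ^ l)%N #|Y| => a b y leC cY.
(* Four parts contribute 4 C 8^l + 4 * 9 * 2 * (512 * 4) * 8^l, which is at most 8 C 8^l as soon as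
   C >= 72 * 512. *)
have h1 : (b * y <= b * (512 * (4 * a)))%N by rewrite leq_mul2l cY orbT.
have h2 : (72 * 512 * (a * b) <= C * (a * b))%N by rewrite leq_mul2r leC orbT.
by move: h1 h2; clear; lia.
Qed.

(** Take [l] with N <= 4^l < 4N. Then 3 * 2^l < p follows from 36 N < p^2, and k <= N^(5/12) gives k
    l <= 6 * 2^l, so the term with [k] is absorbed. The factor 64 is 4^3, from (4N)^3. *)
Lemma incidences_power C N p :
  (72 * 512 <= C)%N -> (forall m, (0 < m < p)%N -> m%:R != 0 :> K) ->
  (#|I| <= N)%N -> (#|J| <= N)%N -> (36 * N < p ^ 2)%N -> (k ^ 12 <= N ^ 5)%N ->
  (inc setT setT ^ 2 <= 64 * (C + 6) ^ 2 * N ^ 3)%N.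
Proof.
move=> leC char_K cI cJ Np kN; case: (posnP N) => [N0|N0].
  have : #|I| = 0%N by apply/eqP; rewrite -leqn0 -N0.
  by move/card0_eq => I0; rewrite /incidences big1 // => i; have := I0 i.
have [l N4l l4N] : exists2 l, (N <= 4 ^ l)%N & (4 ^ l < 4 * N)%N.
  have [N1|N1] := leqP N 1; first by exists 0%N; rewrite // expn0; lia.
  have /andP[lt le] := up_log_bounds (isT : (1 < 4)%N) N1.
  exists (up_log 4 N) => //; case: (up_log 4 N) lt => [|m] /=; first by rewrite expn0; lia.
  by rewrite expnS; lia.
have e4 : ((2 ^ l) ^ 2 = 4 ^ l)%N by rewrite -expnM mulnC expnM.
have char_l m : (0 < m <= 3 * 2 ^ l)%N -> m%:R != 0 :> K.
  case/andP=> m0 ml; apply: char_K; rewrite m0 (leq_ltn_trans ml) //.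
  rewrite -(ltn_exp2r _ _ (isT : (0 < 2)%N)) expnMn e4.
  by apply: leq_ltn_trans _ Np; move: l4N; move: (4 ^ l)%N => a; lia.
have p4 : (0 < 4 ^ l)%N by rewrite expn_gt0.
have := incidences_dyadic leC char_l (X := setT) (Y := setT).
rewrite !cardsT => /(_ (leq_trans cI N4l)) bound.
have {}bound := bound (leq_trans (leq_trans cJ N4l) (leq_pmull _ (isT : (0 < 512)%N))).
have e8 : (8 ^ l = 4 ^ l * 2 ^ l)%N by rewrite -expnMn.
have kl : (k * l <= 6 * 2 ^ l)%N.
  rewrite -(leq_exp2r _ _ (isT : (0 < 6)%N)) !expnMn.
  have k6 : (k ^ 6 <= (2 ^ l) ^ 5)%N.
    rewrite -(leq_exp2r _ _ (isT : (0 < 2)%N)) -[X in (X <= _)%N]expnM -[X in (_ <= X)%N]expnM.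
    rewrite (mulnC 5 2) [X in (_ <= X)%N]expnM e4; apply: leq_trans kN _.
    by rewrite leq_exp2r.
  have := leq_mul k6 (leq_poly_exp2 l).
  by rewrite [X in (_ <= X)%N]mulnCA -[X in (_ <= _ * (_ * X))%N]expn1 -expnD.
have {}bound : (inc setT setT <= (C + 6) * 8 ^ l)%N.
  apply: leq_trans bound _; rewrite mulnDl leq_add2l e8 [(4 ^ l * _)%N]mulnC mulnA.
  by rewrite leq_mul2r kl orbT.
apply: (@leq_trans (((C + 6) * 8 ^ l) ^ 2)%N); first by rewrite leq_exp2r.
have -> : (64 * (C + 6) ^ 2 * N ^ 3 = (C + 6) ^ 2 * (4 * N) ^ 3)%N.
  by rewrite expnMn mulnAC mulnC.
rewrite expnMn leq_mul2l; apply/orP; right.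
have -> : ((8 ^ l) ^ 2 = (4 ^ l) ^ 3)%N by rewrite -!expnM ![(l * _)%N]mulnC !expnM.
by rewrite leq_exp2r // ltnW.
Qed.

End Recursion.

(** * Energies as incidences *)

Section Energy.
Variables (F : fieldType) (TU TV TW : finType).
Variables (uu : TU -> F) (vv : TV -> F) (ww : TW -> F).
Variables (f g : F -> F) (kap : F).
Hypotheses (uu_inj : injective uu) (vv_inj : injective vv) (ww_inj : injective ww).
Hypothesis kap_neq0 : kap != 0.

Local Notation T := (TU * TV * TW)%type.
Definition phase (z : T) : F :=
  f (uu z.1.1) + g (vv z.1.2) + kap * uu z.1.1 * vv z.1.2 + ww z.2.

Local Notation K := {fraction {poly F}}.
Definition emb (x : F) : K := tofrac x%:P.
HB.instance Definition _ := GRing.RMorphism.copy emb (@tofrac {poly F} \o polyC).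
Local Notation t := (tofrac ('X : {poly F})).

Let x1 (i : T) := kap * uu i.1.1.
Let x2 (i : T) := kap * vv i.1.2.
Let x3 (i : T) := f (uu i.1.1) - g (vv i.1.2) - ww i.2.
Let y1 (j : T) := vv j.1.2.
Let y2 (j : T) := uu j.1.1.
Let y3 (j : T) := f (uu j.1.1) - g (vv j.1.2) - ww j.2.

(* The powers of the transcendental [t] put the lines in general position: they
   make [xb] and [yd] injective. *)
Let xc i := emb (x1 i) + t.
Let xd i := emb (x2 i).
Let xb i := (emb (x3 i) + t ^+ 2 * emb (x2 i) + t ^+ 4) / xc i.
Let ya j := - (emb (y2 j) + t ^+ 2).
Let yb j := - emb (y1 j).
Let yd j := (emb (y3 j) + t * emb (y1 j) + t ^+ 4) / ya j.

Lemma emb_inj : injective emb.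
Proof. by move=> x y /eqP; rewrite /emb tofrac_eq => /eqP /polyC_inj. Qed.

Lemma xc_neq0 i : xc i != 0.
Proof.
rewrite /xc /emb -tofracD tofrac_eq0 addrC -size_poly_eq0 size_XaddC //.
Qed.

Lemma ya_neq0 j : ya j != 0.
Proof.
rewrite oppr_eq0 /emb -tofracXn -tofracD tofrac_eq0; apply/eqP => /(congr1 (fun p : {poly F} => p`_2)).
by rewrite coefD coefC coefXn coef0 add0r => /eqP; rewrite oner_eq0.
Qed.

(** After clearing denominators, the terms t [y1], t^2 [x2] and t^4 occur on both sides and
    cancel. *)
Lemma meetsE i j : meets xb xc xd ya yb yd i j = (x3 i + x1 i * y1 j == y3 j + x2 i * y2 j).
Proof.
have embE a b c : emb (a + b * c) = emb a + emb b * emb c by rewrite rmorphD rmorphM.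
rewrite /meets -(inj_eq emb_inj) !embE -subr_eq0 -[RHS]subr_eq0.
congr (_ == 0); rewrite !mulrBr.
have -> : xc i * xb i = emb (x3 i) + t ^+ 2 * emb (x2 i) + t ^+ 4.
  by rewrite mulrC divfK // xc_neq0.
have -> : ya j * yd j = emb (y3 j) + t * emb (y1 j) + t ^+ 4.
  by rewrite mulrC divfK // ya_neq0.
by rewrite /xc /ya /xd /yb; ring.
Qed.

Lemma coords_inj i i' : x1 i = x1 i' -> x2 i = x2 i' -> x3 i = x3 i' -> i = i'.
Proof.
move=> /(mulfI kap_neq0) /uu_inj e1 /(mulfI kap_neq0) /vv_inj e2.
rewrite /x3 e1 e2 => /addrI /oppr_inj /ww_inj e3.
by move: e1 e2 e3; case: i => -[a b] c; case: i' => -[a' b'] c' /= -> -> ->.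
Qed.

(** After cross-multiplication, the coefficients of t, t^3 and t^4 show [x3], [x2] and [x1]; the
    summand t^4 of the numerator is what exposes [x1]. *)
Lemma xb_inj : injective xb.
Proof.
move=> i i' /eqP; rewrite /xb eqr_div ?xc_neq0 // /xc /emb.
rewrite -!(tofracXn, tofracD, tofracM) tofrac_eq => /eqP E.
have normE (a b c : F) : (a%:P + 'X ^+ 2 * b%:P + 'X ^+ 4) * (c%:P + 'X) =
    (a * c)%:P + a%:P * 'X^1 + (b * c)%:P * 'X^2 + b%:P * 'X^3 + c%:P * 'X^4 + 'X^5.
  by rewrite !polyCM; ring.
rewrite !normE in E; have C n := congr1 (fun p : {poly F} => p`_n) E.
move: (C 1) (C 3) (C 4); rewrite !(coefD, coefCM, coefC, coefXn) /=.
rewrite !(mulr0, mulr1, addr0, add0r) => e3 e2 e1.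
by apply: coords_inj; rewrite ?e1.
Qed.

Lemma yd_inj : injective yd.
Proof.
move=> j j' /eqP; rewrite /yd eqr_div ?ya_neq0 // /ya /emb !mulrN eqr_opp.
rewrite -!(tofracXn, tofracD, tofracM) tofrac_eq => /eqP E.
have normE (a b c : F) : (a%:P + 'X * b%:P + 'X ^+ 4) * (c%:P + 'X ^+ 2) =
    (a * c)%:P + (b * c)%:P * 'X^1 + a%:P * 'X^2 + b%:P * 'X^3 + c%:P * 'X^4 + 'X^6.
  by rewrite !polyCM; ring.
rewrite !normE in E; have C n := congr1 (fun p : {poly F} => p`_n) E.
move: (C 2) (C 3) (C 4); rewrite !(coefD, coefCM, coefC, coefXn) /=.
rewrite !(mulr0, mulr1, addr0, add0r) => e3 e1 /esym e2.
by apply: coords_inj => //; [congr (kap * _)|congr (kap * _)].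
Qed.

(** Subtracting the two incidence equations gives a linear relation between [y1 j] and [y2 j]. If it
    involves [y1] or [y2], one of these determines the other and then [y3]; if it involves neither,
    it has no solution. *)
Lemma few_common i i' : i != i' ->
  (#|[set j | meets xb xc xd ya yb yd i j && meets xb xc xd ya yb yd i' j]|
   <= maxn #|TU| #|TV|)%N.
Proof.
move=> ne; set S := [set j | _].
have SE j : j \in S -> x3 i + x1 i * y1 j = y3 j + x2 i * y2 j /\
    (x3 i - x3 i') + (x1 i - x1 i') * y1 j = (x2 i - x2 i') * y2 j.
  rewrite inE !meetsE => /andP[/eqP e1 /eqP e2]; split=> //.
  have -> : (x3 i - x3 i') + (x1 i - x1 i') * y1 j =
    (x3 i + x1 i * y1 j) - (x3 i' + x1 i' * y1 j) by ring.
  by rewrite e1 e2; ring.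
have coordsJ j j' : y1 j = y1 j' -> y2 j = y2 j' -> y3 j = y3 j' -> j = j'.
  by move=> e1 e2 e3; apply: coords_inj; rewrite // /x1 /x2 -/(y1 _) -/(y2 _) ?e1 ?e2.
have [e1|n1] := eqVneq (x1 i) (x1 i'); last first.
  apply: leq_trans (leq_maxl _ _); rewrite -(@card_in_imset _ _ (fun j => j.1.1) S) ?max_card //.
  move=> j j' /SE[a1 a2] /SE[b1 b2] e; have e2 : y2 j = y2 j' by rewrite /y2 e.
  have e1 : y1 j = y1 j'.
    have nz : x1 i - x1 i' != 0 by rewrite subr_eq0.
    by apply: (mulfI nz); apply: (addrI (x3 i - x3 i')); rewrite a2 b2 e2.
  apply: coordsJ => //; apply: (addIr (x2 i * y2 j)).
  by rewrite -a1 e1 b1 e2.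
have [e2|n2] := eqVneq (x2 i) (x2 i'); last first.
  apply: leq_trans (leq_maxr _ _); rewrite -(@card_in_imset _ _ (fun j => j.1.2) S) ?max_card //.
  move=> j j' /SE[a1 a2] /SE[b1 b2] e; have e1' : y1 j = y1 j' by rewrite /y1 e.
  have e2 : y2 j = y2 j'.
    have nz : x2 i - x2 i' != 0 by rewrite subr_eq0.
    by apply: (mulfI nz); rewrite -a2 -b2 e1'.
  apply: coordsJ => //; apply: (addIr (x2 i * y2 j)).
  by rewrite -a1 e1' b1 e2.
rewrite eq_card0 // => j; apply/negP => /SE[_]; rewrite e1 e2 !subrr !mul0r addr0.
by move/eqP; rewrite subr_eq0 => /eqP e3; case/eqP: ne; apply: coords_inj.
Qed.

Lemma frac_infinite m : exists2 s : seq K, uniq s & size s = m.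
Proof.
exists [seq t ^+ i | i <- iota 0 m]; last by rewrite size_map size_iota.
rewrite map_inj_uniq ?iota_uniq // => i j /eqP; rewrite -!tofracXn tofrac_eq => /eqP.
by move/(congr1 (fun p : {poly F} => (size p).-1)); rewrite !size_polyXn.
Qed.

Definition energy := #|[set z : T * T | phase z.1 == phase z.2]|.

Lemma energy_incidences : (energy <= incidences xb xc xd ya yb yd setT setT)%N.
Proof.
(* Exchanging the v- and w-entries of the two triples gives each product u v one factor from either
   side, as an incidence requires. *)
pose sw (z : T * T) : T * T :=
  ((z.1.1.1, z.2.1.2, z.2.2), (z.2.1.1, z.1.1.2, z.1.2)).
have sw_inj : injective sw.
  by move=> [[[a b] c] [[a' b'] c']] [[[a1 b1] c1] [[a1' b1'] c1']] [] /= -> -> -> -> -> ->.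
rewrite /energy -(card_imset _ sw_inj).
apply: (@leq_trans #|[set z : T * T | meets xb xc xd ya yb yd z.1 z.2]|).
  apply/subset_leq_card/subsetP => _ /imsetP[z + ->]; rewrite !inE meetsE.
  rewrite /phase /sw /x1 /x2 /x3 /y1 /y2 /y3 /= => /eqP E; rewrite -subr_eq0.
  move/eqP: E; rewrite -subr_eq0 => /eqP <-; apply/eqP; ring.
rewrite /incidences -sum1dep_card.
under [X in (_ <= X)%N]eq_bigr do rewrite -sum1dep_card.
rewrite pair_big_dep /= leq_eqVlt; apply/orP; left; apply/eqP.
by apply: eq_bigl => z; rewrite !inE.
Qed.

Lemma energy_bound C N p : p \in [pchar F] ->
  (72 * 512 <= C)%N -> (#|TU| * #|TV| * #|TW| <= N)%N -> (36 * N < p ^ 2)%N ->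
  (maxn #|TU| #|TV| ^ 12 <= N ^ 5)%N ->
  (energy ^ 2 <= 64 * (C + 6) ^ 2 * N ^ 3)%N.
Proof.
move=> pF leC cN Np kN; have cT : (#|{: T}| <= N)%N by rewrite !card_prod.
apply: (@leq_trans (incidences xb xc xd ya yb yd setT setT ^ 2)).
  by rewrite leq_exp2r // energy_incidences.
apply: (incidences_power frac_infinite xb_inj yd_inj xc_neq0 ya_neq0 few_common leC
  _ cT cT Np kN) => m /andP[m0 mp].
have -> : m%:R = emb m%:R by rewrite rmorph_nat.
rewrite -(rmorph0 emb) (inj_eq emb_inj) -(dvdn_pcharf pF).
by rewrite gtnNdvd.
Qed.

End Energy.

Local Open Scope fset_scope.
Local Open Scope ring_scope.

(** * Collisions and sumsets *)

Section FsetCounting.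
Variables T T' : choiceType.
Implicit Types (X : {fset T}) (Y : {fset T'}).

Lemma perm_fsetM X Y : perm_eq (X `*` Y) [seq (x, y) | x <- X, y <- Y].
Proof.
apply: uniq_perm; rewrite ?fset_uniq ?allpairs_uniq //; first by case=> [a b] [].
move=> z; rewrite in_fsetM; apply/andP/allpairsP => [[z1 z2]|[[x y] /= [xX yY ->]]] //.
by exists z; case: z z1 z2.
Qed.

Lemma cardfsM X Y : #|` X `*` Y| = (#|` X| * #|` Y|)%N.
Proof. by rewrite (perm_size (perm_fsetM X Y)) size_allpairs. Qed.

Lemma card_fset_count X (P : pred T) : #|` [fset x in X | P x]| = count P X.
Proof.
rewrite -size_filter; apply: perm_size; apply: uniq_perm; rewrite ?filter_uniq ?fset_uniq //.
by move=> x; rewrite mem_filter !inE /= andbC.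
Qed.

Lemma leq_card_inj X Y (h : T -> T') :
  {in X &, injective h} -> (forall x, x \in X -> h x \in Y) -> (#|` X| <= #|` Y|)%N.
Proof.
move=> h_inj hXY; rewrite -(card_in_imfset imfset_key h_inj).
by apply/fsubset_leq_card/fsubsetP => _ /imfsetP[x /= xX ->]; apply: hXY.
Qed.

End FsetCounting.

Definition collisions (T T' : choiceType) (X : {fset T}) (f : T -> T') :=
  [fset z in X `*` X | f z.1 == f z.2].

Lemma in_collisions (T T' : choiceType) (X : {fset T}) (f : T -> T') z :
  (z \in collisions X f) = [&& z.1 \in X, z.2 \in X & f z.1 == f z.2].
Proof. by rewrite !inE -andbA. Qed.

Lemma cauchy_schwarz_nat (T : eqType) (s : seq T) (c : T -> nat) :
  ((\sum_(x <- s) c x) ^ 2 <= size s * \sum_(x <- s) c x ^ 2)%N.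
Proof.
elim: s => [|x s IH]; rewrite ?big_nil // !big_cons /=.
have h : (2 * c x * (\sum_(y <- s) c y) <= size s * c x ^ 2 + \sum_(y <- s) c y ^ 2)%N.
  elim: (s) => [|y r IHr]; rewrite ?big_nil ?muln0 // !big_cons /=.
  have [+ _] := nat_Cauchy (c x) (c y).
  move: IHr; move: (\sum_(_ <- r) _)%N (\sum_(_ <- r) _)%N (size r) => a b m; nia.
move: h IH; move: (\sum_(_ <- s) _)%N (\sum_(_ <- s) _)%N (size s) => a b m; nia.
Qed.

(** Cauchy-Schwarz for the sizes of the fibres of [f]. *)
Lemma card_collisions (T T' : choiceType) (X : {fset T}) (S : {fset T'}) (f : T -> T') :
  (forall x, x \in X -> f x \in S) ->
  (#|` X| ^ 2 <= #|` S| * #|` collisions X f|)%N.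
Proof.
move=> fXS; pose c s := (\sum_(x <- X) (f x == s))%N.
have one x : x \in X -> (\sum_(s <- S) (f x == s) = 1)%N.
  move=> xX; rewrite (big_rem (f x)) ?fXS //= eqxx big_seq big1 ?addn0 // => s.
  by rewrite rem_filter ?fset_uniq // mem_filter /= eq_sym => /andP[/negPf ->].
have -> : #|` X| = (\sum_(s <- S) c s)%N.
  rewrite exchange_big /= -sum1_size [LHS]big_seq [RHS]big_seq.
  by apply: eq_bigr => x /one.
suff -> : #|` collisions X f| = (\sum_(s <- S) c s ^ 2)%N by apply: cauchy_schwarz_nat.
rewrite card_fset_count -sum1_count big_mkcond /= (perm_big _ (perm_fsetM X X)) /=.
rewrite big_allpairs /=.
transitivity (\sum_(s <- S) \sum_(x <- X) \sum_(y <- X) (f x == s) * (f y == s))%N; last first.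
  apply: eq_bigr => s _; rewrite /c -mulnn big_distrl /=; apply: eq_bigr => x _.
  by rewrite big_distrr.
rewrite [RHS]exchange_big /= [LHS]big_seq [RHS]big_seq; apply: eq_bigr => x xX.
rewrite [RHS]exchange_big /=; apply: eq_bigr => y _.
rewrite (big_rem (f x)) ?fXS //= eqxx mul1n [f y == _]eq_sym big_seq big1 ?addn0.
  by case: (_ == _).
move=> s; rewrite rem_filter ?fset_uniq // mem_filter /= eq_sym => /andP[/negPf ->].
by rewrite mul0n.
Qed.

Lemma collisions_energy (F : fieldType) (U V W : {fset F}) (f g : F -> F) (kap : F) :
  (#|` collisions (U `*` V `*` W)
       (fun z => f z.1.1 + g z.1.2 + kap * z.1.1 * z.1.2 + z.2)%R| <=
   energy (val : U -> F) (val : V -> F) (val : W -> F) f g kap)%N.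
Proof.
rewrite /energy; set E := [set z | _].
pose h (z : U * V * W * (U * V * W)) : F * F * F * (F * F * F) :=
  ((val z.1.1.1, val z.1.1.2, val z.1.2), (val z.2.1.1, val z.2.1.2, val z.2.2)).
apply: (@leq_trans #|` [fset h z | z in E]|); last first.
  by rewrite cardE; apply: leq_imfset_card.
apply/fsubset_leq_card/fsubsetP => -[[[u v] w] [[u' v'] w']].
rewrite !inE /= => /andP[/andP[/andP[/andP[uU vV] wW] /andP[/andP[u'U v'V] w'W]] e].
apply/imfsetP; exists (([` uU], [` vV], [` wW]), ([` u'U], [` v'V], [` w'W])) => //=.
by rewrite inE.
Qed.

Section SumSets.
Variable V : zmodType.
Implicit Types A B : {fset V}.

Lemma sumsetP A B x :
  reflect (exists a b, [/\ a \in A, b \in B & x = a + b]) (x \in sumset A B).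
Proof.
apply: (iffP idP) => [/imfset2P[a /= aA [b /= bB ->]]|[a [b [aA bB ->]]]].
  by exists a, b.
by apply/imfset2P; exists a => //; exists b.
Qed.

Lemma diffsetP A B x :
  reflect (exists a b, [/\ a \in A, b \in B & x = a - b]) (x \in diffset A B).
Proof.
apply: (iffP idP) => [/imfset2P[a /= aA [b /= bB ->]]|[a [b [aA bB ->]]]].
  by exists a, b.
by apply/imfset2P; exists a => //; exists b.
Qed.

Lemma mem_sumset A B a b : a \in A -> b \in B -> a + b \in sumset A B.
Proof. by move=> aA bB; apply/sumsetP; exists a, b. Qed.

Lemma mem_diffset A B a b : a \in A -> b \in B -> a - b \in diffset A B.
Proof. by move=> aA bB; apply/diffsetP; exists a, b. Qed.

Lemma sumsetC A B : sumset A B = sumset B A.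
Proof.
by apply/fsetP => x; apply/sumsetP/sumsetP => -[a [b [aA bB ->]]]; exists b, a; rewrite addrC.
Qed.

Lemma leq_card_sumsetr A B : (0 < #|` A|)%N -> (#|` B| <= #|` sumset A B|)%N.
Proof.
rewrite cardfs_gt0 => /fset0Pn[a aA].
by apply: (leq_card_inj (h := +%R a)) => [x y _ _ /addrI|x xB]; [|apply: mem_sumset].
Qed.

Lemma leq_card_sumsetl A B : (0 < #|` B|)%N -> (#|` A| <= #|` sumset A B|)%N.
Proof. by rewrite sumsetC; apply: leq_card_sumsetr. Qed.

Lemma leq_card_diffset A : (#|` A| <= #|` diffset A A|)%N.
Proof.
have [->|/fset0Pn[a aA]] := eqVneq A fset0; first by rewrite cardfs0.
apply: (leq_card_inj (h := fun x => x - a)) => [x y _ _ /addIr //|x xB].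
exact: mem_diffset.
Qed.

(* Ruzsa's triangle inequality: [a1 - a2] and [b] are recovered from
   [a1 + b] and [a2 + b]. *)
Lemma ruzsa_triangle A B : (#|` diffset A A| * #|` B| <= #|` sumset A B| ^ 2)%N.
Proof.
have /choice[r rP] x : exists r : V * V, x \in diffset A A ->
    [/\ r.1 \in A, r.2 \in A & x = r.1 - r.2].
  have [/diffsetP[a [b [aA bA ->]]]|nx] := boolP (x \in diffset A A); last by exists (0, 0).
  by exists (a, b).
rewrite -mulnn -!cardfsM.
apply: (leq_card_inj (h := fun z => ((r z.1).1 + z.2, (r z.1).2 + z.2))).
  move=> [x b] [x' b']; rewrite !in_fsetM /= => /andP[/rP[_ _ xE] _] /andP[/rP[_ _ x'E] _] [e1 e2].
  have ex : x = x'.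
    have shift (y z w : V) : y - z = (y + w) - (z + w) by rewrite opprD addrACA subrr addr0.
    by rewrite xE x'E (shift _ _ b) e1 e2 -shift.
  by move: e1; rewrite ex => /addrI ->.
by move=> [x b]; rewrite !in_fsetM /= => /andP[/rP[a1 a2 _] bB]; rewrite !mem_sumset.
Qed.

(* [n^4 <= |A - A| E] for the additive energy [E], while from [x] in [A + A] and
   a quadruple [a + d = c + b] one recovers everything from [x1 - c], [x2 - b], [a], [d]. *)
Lemma card_sumset_diffset A :
  (#|` sumset A A| * #|` A| ^ 2 <= #|` diffset A A| ^ 3)%N.
Proof.
have /choice[r rP] x : exists r : V * V, x \in sumset A A ->
    [/\ r.1 \in A, r.2 \in A & x = r.1 + r.2].
  have [/sumsetP[a [b [aA bA ->]]]|nx] := boolP (x \in sumset A A); last by exists (0, 0).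
  by exists (a, b).
set D := diffset A A; set n := #|` A|; set S := sumset A A.
have [->|n0] := posnP n; first by rewrite exp0n // muln0.
pose E := collisions (A `*` A) (fun z : V * V => z.1 - z.2).
have cE : (n ^ 2 * n ^ 2 <= #|` D| * #|` E|)%N.
  have := @card_collisions _ _ (A `*` A) D (fun z => z.1 - z.2).
  rewrite cardfsM -expnMn mulnn -/n; apply => z; rewrite in_fsetM => /andP[z1 z2].
  exact: mem_diffset.
have cSE : (#|` S| * #|` E| <= #|` D| ^ 2 * n ^ 2)%N.
  rewrite -!mulnn -!cardfsM.
  apply: (leq_card_inj (h := fun z : V * (V * V * (V * V)) =>
    (((r z.1).1 - z.2.2.1, (r z.1).2 - z.2.1.2), (z.2.1.1, z.2.2.2)))).
    move=> [x [[a b] [c d]]] [x' [[a' b'] [c' d']]]; rewrite !inE /=.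
    move=> /andP[/rP[_ _ xE] /andP[_ /eqP e]] /andP[/rP[_ _ x'E] /andP[_ /eqP e']].
    move=> [e1 e2 ea ed]; subst a' d'.
    have ad : a + d = c + b by rewrite -(subrK b a) e addrAC subrK.
    have ad' : a + d = c' + b' by rewrite -(subrK b' a) e' addrAC subrK.
    have ex : x = x'.
      have -> : x = ((r x).1 - c) + ((r x).2 - b) + (a + d).
        by rewrite {1}xE ad [X in _ = X + _]addrACA -opprD subrK.
      by rewrite e1 e2 ad' [in RHS]x'E [X in X + _]addrACA -opprD subrK.
    move: e1 e2; rewrite ex => /addrI /oppr_inj -> /addrI /oppr_inj ->; done.
  move=> [x [[a b] [c d]]]; rewrite !inE /= => /andP[/rP[x1 x2 _] /andP[/andP[/andP[aA bA] /andP[cA dA]] _]].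
  by rewrite !mem_diffset // aA dA.
rewrite -(leq_pmul2r (m := n ^ 2)) ?expn_gt0 ?n0 // -mulnA.
apply: leq_trans (leq_mul (leqnn _) cE) _;
by rewrite mulnCA (expnS _ 2) -mulnA leq_mul2l cSE orbT.
Qed.

End SumSets.

(** * Energies of powers *)

Section PowerSets.
Variable F : fieldType.
Implicit Types A B C G : {fset F}.

Lemma mem_powset A (d : nat) a : a \in A -> a ^+ d \in powset A d.
Proof. by move=> aA; apply/imfsetP; exists a. Qed.

Lemma card_powset A d : (#|` powset A d| <= #|` A|)%N.
Proof. exact: leq_imfset_card. Qed.

Lemma leq_card_powset A (d : nat) : (0 < d)%N -> (#|` A| <= d * #|` powset A d|)%N.
Proof.
move=> d0; rewrite -sum1_size big_seq.
apply: (@leq_trans (\sum_(a <- A | a \in A) \sum_(y <- powset A d) (a ^+ d == y))%N).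
  by apply: leq_sum => a aA; rewrite (big_rem (a ^+ d)) ?mem_powset //= eqxx.
rewrite -big_seq exchange_big /=.
apply: (@leq_trans (\sum_(y <- powset A d) d)%N); last first.
  by rewrite big_const_seq count_predT iter_addn addn0.
apply: leq_sum => y _.
have -> : (\sum_(a <- A) (a ^+ d == y) = size [seq a <- A | a ^+ d == y])%N.
  by rewrite size_filter -sum1_count [RHS]big_mkcond; apply: eq_bigr => a _; case: (_ == _).
rewrite -ltnS -(size_XnsubC y d0); apply: max_poly_roots.
- by rewrite -size_poly_eq0 size_XnsubC.
- apply/allP => a; rewrite mem_filter => /andP[/eqP <- _].
  by rewrite /root hornerD hornerN hornerC hornerXn subrr.
- by rewrite filter_uniq ?fset_uniq.
Qed.

End PowerSets.

Section Bounds.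
Variables (F : fieldType) (p C0 : nat).
Hypotheses (pF : p \in [pchar F]) (leC0 : (72 * 512 <= C0)%N).
Implicit Types A G C : {fset F}.

Lemma natr_neq0 m : (0 < m < p)%N -> m%:R != 0 :> F.
Proof. by move=> /andP[m0 mp]; rewrite -(dvdn_pcharf pF) gtnNdvd. Qed.

(* Each [a] is (a + e) - e for all [e] in [G], and ((a + e) - e) ^ 2 is a bilinear
   term plus functions of a + e and of e. *)
Lemma quadratic_bound A G C : (2 < p)%N ->
  let N := (#|` sumset A G| * #|` G| * #|` C|)%N in
  (36 * N < p ^ 2)%N -> (#|` G| <= #|` sumset A G|)%N ->
  (#|` sumset A G| ^ 12 <= N ^ 5)%N ->
  ((#|` A| * #|` C| * #|` G|) ^ 4 <=
   #|` sumset (powset A 2) C| ^ 2 * (64 * (C0 + 6) ^ 2 * N ^ 3))%N.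
Proof.
move=> p2 N Np GM kN; set M := sumset A G in N Np GM kN *.
set T := sumset _ C.
pose E := collisions (A `*` C) (fun z => z.1 ^+ 2 + z.2).
have cE : ((#|` A| * #|` C|) ^ 2 <= #|` T| * #|` E|)%N.
  rewrite -cardfsM; apply: card_collisions => z; rewrite in_fsetM => /andP[z1 z2].
  by apply: mem_sumset => //; apply: (mem_powset 2).
set en := energy (val : M -> F) (val : G -> F) (val : C -> F)
  (fun x => x ^+ 2) (fun x => x ^+ 2) (- 2%:R).
(* Each collision is counted once for every pair of independent shifts in [G]. *)
have cEG : (#|` E| * #|` G| ^ 2 <= en)%N.
  apply: leq_trans (collisions_energy M G C (fun x => x ^+ 2) (fun x => x ^+ 2) (- 2%:R)).
  rewrite -mulnn -!cardfsM.
  apply: (leq_card_inj (h := fun z : (F * F) * (F * F) * (F * F) =>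
    ((z.1.1.1 + z.2.1, z.2.1, z.1.1.2), (z.1.2.1 + z.2.2, z.2.2, z.1.2.2)))).
    move=> [[[a c] [a' c']] [e e']] [[[b d] [b' d']] [f f']] _ _ /=.
    move=> [ea ef -> ea' ef' ->]; rewrite ef ef' in ea ea' *.
    by rewrite (addIr _ ea) (addIr _ ea').
  move=> [[[a c] [a' c']] [e e']]; rewrite !inE /=.
  move=> /andP[/andP[/andP[/andP[aA cC] /andP[a'A c'C]] /eqP ac] /andP[eG e'G]].
  rewrite !mem_sumset // eG e'G cC c'C /=; apply/eqP.
  have shape (x y z : F) : (x + y) ^+ 2 + y ^+ 2 + - 2%:R * (x + y) * y + z = x ^+ 2 + z by ring.
  by rewrite !shape.
have bound : (en ^ 2 <= 64 * (C0 + 6) ^ 2 * N ^ 3)%N.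
  apply: (energy_bound _ _ val_inj val_inj val_inj _ pF leC0 _ Np); rewrite -?cardfE //.
    by rewrite oppr_eq0 natr_neq0.
  by rewrite (maxn_idPl GM).
apply: leq_trans (leq_mul (leqnn _) bound); rewrite -expnMn -[4%N]/(2 * 2)%N expnM leq_exp2r //.
by rewrite expnMn; apply: leq_trans (leq_mul cE (leqnn _)) _; rewrite -mulnA leq_mul2l cEG orbT.
Qed.

(* 4 (a ^ 3 - b ^ 3) = (a - b) ^ 3 + 3 (a - b) (a + b) ^ 2 *)
Lemma cubic_bound A C : (3 < p)%N ->
  let D := diffset A A in let S := sumset A A in
  let N := (#|` D| * #|` S| * #|` C|)%N in
  (36 * N < p ^ 2)%N -> (maxn #|` D| #|` S| ^ 12 <= N ^ 5)%N ->
  ((#|` A| * #|` C|) ^ 8 <=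
   #|` sumset (powset A 3) C| ^ 4 * (16 * #|` C| ^ 2 * (64 * (C0 + 6) ^ 2 * N ^ 3)))%N.
Proof.
move=> p3 D S N Np kN; set T := sumset _ C.
have n2 : 2%:R != 0 :> F := @natr_neq0 2 (ltnW p3).
have n4 : 4%:R != 0 :> F.
  by have -> : 4%:R = 2%:R * 2%:R :> F; [rewrite -natrM|apply: mulf_neq0].
have n3 : 3%:R != 0 :> F := @natr_neq0 3 p3.
pose E := collisions (A `*` C) (fun z => z.1 ^+ 3 + z.2).
have cE : ((#|` A| * #|` C|) ^ 2 <= #|` T| * #|` E|)%N.
  rewrite -cardfsM; apply: card_collisions => z; rewrite in_fsetM => /andP[z1 z2].
  by apply: mem_sumset => //; apply: (mem_powset 3).
(* In a collision a^3 + c = b^3 + d the entry d is [phi (a, b, c)]. A second Cauchy-Schwarz, over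
   the values of [phi] in [C], produces the energy. *)
pose phi (z : F * F * F) := z.1.1 ^+ 3 - z.1.2 ^+ 3 + z.2.
pose Y := [fset z in A `*` A `*` C | phi z \in C].
have cY : (#|` E| <= #|` Y|)%N.
  apply: (leq_card_inj (h := fun z : (F * F) * (F * F) => (z.1.1, z.2.1, z.1.2))).
    move=> [[a c] [b d]] [[a' c'] [b' d']]; rewrite !inE /=.
    move=> /andP[_ /eqP e] /andP[_ /eqP e'] [ea eb ec]; subst a' b' c'.
    by move: e'; rewrite e => /addrI ->.
  move=> [[a c] [b d]]; rewrite !inE /phi /= => /andP[/andP[/andP[-> ->] /andP[-> dC]] /eqP e].
  by rewrite addrAC e addrAC subrr add0r.
have cYY : (#|` Y| ^ 2 <= #|` C| * #|` collisions Y phi|)%N.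
  by apply: card_collisions => z; rewrite !inE => /andP[].
(* A fixed choice of square roots: [bit] records the sign of a + b, which is lost in passing to its
   square. *)
have /choice[rho rhoP] x : exists r : F, forall s, s ^+ 2 = x -> r ^+ 2 = x.
  have [[s sx]|nx] := pselect (exists s : F, s ^+ 2 = x); first by exists s.
  by exists 0 => s sx; case: nx; exists s.
pose bit (z : F * F * F) := z.1.1 + z.1.2 == rho ((z.1.1 + z.1.2) ^+ 2).
have bit_inj (z z' : F * F * F) : (z.1.1 + z.1.2) ^+ 2 = (z'.1.1 + z'.1.2) ^+ 2 ->
    bit z = bit z' -> z.1.1 + z.1.2 = z'.1.1 + z'.1.2.
  rewrite /bit; move: (z.1.1 + z.1.2) (z'.1.1 + z'.1.2) => s s' es.
  have := rhoP (s ^+ 2) s erefl; rewrite -es; move: (rho _) => r r2.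
  have root_or x : x ^+ 2 = s ^+ 2 -> x != r -> x = - r.
    by move=> xs xr; move/eqP: xs; rewrite -r2 eqf_sqr (negPf xr) /= => /eqP.
  case: eqP => [->|/eqP s1]; case: eqP => [-> //|/eqP s2] // _.
  by rewrite (root_or s) // (root_or s').
pose S2 := powset S 2.
pose f x : F := x ^+ 3 / 4%:R.
pose kap : F := 3%:R / 4%:R.
pose Psi (z : F * F * F) := f z.1.1 + 0 + kap * z.1.1 * z.1.2 + z.2.
pose h (z : F * F * F) : F * F * F := (z.1.1 - z.1.2, (z.1.1 + z.1.2) ^+ 2, z.2).
have PsiE z : Psi (h z) = phi z.
  by case: z => [[a b] c]; rewrite /Psi /f /kap /phi /=; field.
have h_inj z z' : h z = h z' -> bit z = bit z' -> z = z'.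
  move=> [e1 e2 e3] eb; have e4 := bit_inj _ _ e2 eb.
  case: z z' e1 e3 e4 {e2 eb} => [[a b] c] [[a' b'] c'] /= e1 -> e4.
  have ea : a = a'.
    have dbl (x y : F) : (x - y) + (x + y) = 2%:R * x by ring.
    by apply: (mulfI n2); rewrite -(dbl a b) -(dbl a' b') e1 e4.
  by move: e4; rewrite ea => /addrI ->.
pose B := [fset true; false].
set en := energy (val : D -> F) (val : S2 -> F) (val : C -> F) f (fun=> 0) kap.
(* The factor 4 accounts for the two bits of a pair of triples. *)
have cen : (#|` collisions Y phi| <= 4 * en)%N.
  apply: leq_trans (leq_mul (leqnn 4) (collisions_energy D S2 C f (fun=> 0) kap)).
  have -> : 4%N = #|` B `*` B| by rewrite cardfsM cardfs2.
  rewrite -cardfsM; apply: (leq_card_inj (h := fun z : (F * F * F) * (F * F * F) =>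
    ((bit z.1, bit z.2), (h z.1, h z.2)))).
    move=> [z1 z2] [z1' z2'] _ _ /= e.
    have [[b1 b2] [h1 h2]] : (bit z1 = bit z1' /\ bit z2 = bit z2') /\ (h z1 = h z1' /\ h z2 = h z2').
      move: e; move: (bit _) (bit _) (bit _) (bit _) (h _) (h _) (h _) (h _).
      by move=> ? ? ? ? ? ? ? ? [-> -> -> ->].
    by rewrite (h_inj _ _ h1 b1) (h_inj _ _ h2 b2).
  move=> [z1 z2]; rewrite in_collisions /= => /and3P[z1Y z2Y e].
  have hY z : z \in Y -> h z \in D `*` S2 `*` C.
    rewrite !inE /= => /andP[/andP[/andP[aA bA] cC] _].
    by rewrite cC mem_diffset //=; apply/andP; split=> //; apply: (mem_powset 2); apply: mem_sumset.
  have {}e : Psi (h z1) == Psi (h z2) by rewrite !PsiE.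
  rewrite in_fsetM in_collisions /= !hY //=; apply/andP; split=> //.
  by rewrite !inE; case: (bit _); case: (bit _).
have bound : (en ^ 2 <= 64 * (C0 + 6) ^ 2 * N ^ 3)%N.
  have S2S : (#|` S2| <= #|` S|)%N by apply: card_powset.
  apply: (energy_bound _ _ val_inj val_inj val_inj _ pF leC0 _ Np); rewrite -?cardfE //.
  - by rewrite mulf_neq0 // invr_neq0.
  - by rewrite leq_mul // leq_mul.
  - apply: leq_trans kN; rewrite leq_exp2r // geq_max leq_maxl /=.
    exact: leq_trans S2S (leq_maxr _ _).
have step1 : ((#|` A| * #|` C|) ^ 8 <= #|` T| ^ 4 * #|` Y| ^ 4)%N.
  rewrite -expnMn -[8%N]/(2 * 4)%N expnM leq_exp2r //.
  by apply: leq_trans cE _; rewrite leq_mul2l cY orbT.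
apply: leq_trans step1 _; rewrite leq_mul2l; apply/orP; right.
rewrite -[4%N]/(2 * 2)%N expnM; apply: (@leq_trans ((#|` C| * (4 * en)) ^ 2)%N).
  by rewrite leq_exp2r //; apply: leq_trans cYY _; rewrite leq_mul2l cen orbT.
have sqE c e : ((c * (4 * e)) ^ 2 = 16 * c ^ 2 * e ^ 2)%N by rewrite !expnMn mulnCA mulnA.
by rewrite sqE leq_mul2l bound orbT.
Qed.

End Bounds.

(** * Numerical inequalities *)

Section Arithmetic.
Local Open Scope nat_scope.
Variables (n p K : nat).
Hypotheses (n_gt0 : 0 < n) (np : n ^ 5 < p ^ 3).

Lemma leq_exp10_p6 : n ^ 10 <= (p ^ 2) ^ 3.
Proof.
have -> : n ^ 10 = (n ^ 5) ^ 2 by rewrite -expnM.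
have -> : (p ^ 2) ^ 3 = (p ^ 3) ^ 2 by rewrite -!expnM.
by rewrite leq_exp2r // ltnW.
Qed.

(* If one of the two hypotheses of [energy_bound] fails, then the sumset is already
   large. *)
Lemma large_sumset_p x : p ^ 2 <= x * n ^ 2 -> n ^ 4 <= x ^ 3.
Proof.
move=> px; rewrite -(leq_pmul2r (m := n ^ 6)) ?expn_gt0 ?n_gt0 // -expnD.
apply: leq_trans leq_exp10_p6 _; have -> : n ^ 6 = (n ^ 2) ^ 3 by rewrite -expnM.
by rewrite -expnMn leq_exp2r.
Qed.

(** Cancelling [x ^ 5] leaves n^10 <= (2x)^7, and 10/7 exceeds 4/3. *)
Lemma large_sumset_collinear a x : n <= 2 * a -> 0 < x ->
  (x * (n * a)) ^ 5 < x ^ 12 -> n ^ 4 <= (2 * x) ^ 3.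
Proof.
move=> na x0; rewrite expnMn (expnD x 5 7) ltn_pmul2l ?expn_gt0 ?x0 // => lt.
have h : n ^ 10 <= (2 * x) ^ 7.
  have -> : n ^ 10 = (n ^ 2) ^ 5 by rewrite -expnM.
  apply: (@leq_trans ((2 * (n * a)) ^ 5)).
    by rewrite leq_exp2r // mulnCA -mulnn leq_mul2l na orbT.
  rewrite expnMn (expnMn 2 x); apply: leq_mul; last exact: ltnW.
  by rewrite leq_exp2l.
rewrite -(leq_exp2r _ _ (isT : 0 < 7)) -!expnM (mulnC 3 7) (expnM _ 7 3).
apply: leq_trans (_ : (n ^ 10) ^ 3 <= _); last by rewrite leq_exp2r.
by rewrite -expnM leq_pexp2l.
Qed.

(** Here [a], [x], [T] are the sizes of A^2, A + A and A^2 + A^2. In the main case, cancelling n^3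
    a^3 gives n^6 <= 2 K T^2 x^3, to be multiplied by n^2 <= 4 T^2. *)
Lemma arith_squares a x T : n <= 2 * a -> a <= n -> a <= T -> n <= x ->
  (36 * (x * n * a) < p ^ 2 -> x ^ 12 <= (x * n * a) ^ 5 ->
   (n * a * n) ^ 4 <= T ^ 2 * (K * (x * n * a) ^ 3)) ->
  n ^ 8 <= (16 * 36 ^ 3 + 8 * K) * (x ^ 3 * T ^ 4).
Proof.
move=> na an aT nx H; have x0 : 0 < x by apply: leq_trans nx.
have nT : n <= 2 * T by apply: leq_trans na _; rewrite leq_mul2l aT orbT.
have big : n ^ 4 <= (36 * x) ^ 3 -> n ^ 8 <= 16 * 36 ^ 3 * (x ^ 3 * T ^ 4).
  move=> h; rewrite (expnD n 4 4) [16 * _]mulnC mulnACA -(expnMn 36 x 3).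
  by apply: leq_mul h _; rewrite -[16]/(2 ^ 4) -expnMn leq_exp2r.
rewrite mulnDl.
have [h1|h1] := ltnP (36 * (x * n * a)) (p ^ 2); last first.
  apply: leq_trans (leq_addr _ _); apply/big/large_sumset_p; apply: leq_trans h1 _.
  by rewrite -!mulnA leq_mul2l /= leq_mul2l -mulnn leq_mul2l an !orbT.
have [h2|h2] := leqP (x ^ 12) ((x * n * a) ^ 5); last first.
  apply: leq_trans (leq_addr _ _); apply: big.
  rewrite -mulnA in h2; apply: leq_trans (large_sumset_collinear na x0 h2) _.
  by rewrite leq_exp2r // leq_mul2r orbT.
apply: leq_trans (leq_addl _ _); have {H} := H h1 h2.
have a0 : 0 < a by move: n_gt0 na; clear; lia.
have e1 : (n * a * n) ^ 4 = (n ^ 3 * a ^ 3) * (n ^ 5 * a) by clear; nia.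
have e2 : T ^ 2 * (K * (x * n * a) ^ 3) = (n ^ 3 * a ^ 3) * (K * T ^ 2 * x ^ 3) by clear; nia.
rewrite e1 e2 leq_pmul2l ?muln_gt0 ?expn_gt0 ?n_gt0 ?a0 // => h.
have h6 : n ^ 6 <= 2 * (K * T ^ 2 * x ^ 3).
  rewrite expnSr; apply: leq_trans (leq_mul (leqnn _) na) _.
  by rewrite mulnCA leq_mul2l h orbT.
rewrite (expnD n 6 2); apply: leq_trans (leq_mul h6 (_ : n ^ 2 <= (2 * T) ^ 2)) _.
  by rewrite leq_exp2r.
by rewrite leq_eqVlt; apply/orP; left; apply/eqP; clear; nia.
Qed.

Lemma arith_mixed_square a m : n <= 2 * a -> a <= n -> n <= m ->
  (36 * (m * a * n) < p ^ 2 -> m ^ 12 <= (m * a * n) ^ 5 ->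
   (n * n * a) ^ 4 <= m ^ 2 * (K * (m * a * n) ^ 3)) ->
  n ^ 11 <= (36 ^ 10 + 4 * K ^ 2) * m ^ 10.
Proof.
move=> na an nm H; have m0 : 0 < m by apply: leq_trans nm.
have big : n ^ 4 <= (36 * m) ^ 3 -> n ^ 11 <= 36 ^ 10 * m ^ 10.
  move=> h; rewrite -expnMn -(leq_exp2r _ _ (isT : 0 < 3)) -!expnM.
  apply: (@leq_trans ((n ^ 4) ^ 10)); first by rewrite -expnM leq_pexp2l.
  by rewrite (mulnC 10) (expnM _ 3) leq_exp2r.
rewrite mulnDl.
have [h1|h1] := ltnP (36 * (m * a * n)) (p ^ 2); last first.
  apply: leq_trans (leq_addr _ _); apply/big/large_sumset_p; apply: leq_trans h1 _.
  by rewrite -!mulnA leq_mul2l /= leq_mul2l -mulnn leq_mul2r an !orbT.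
have [h2|h2] := leqP (m ^ 12) ((m * a * n) ^ 5); last first.
  apply: leq_trans (leq_addr _ _); apply: big.
  rewrite -mulnA (mulnC a) in h2; apply: leq_trans (large_sumset_collinear na m0 h2) _.
  by rewrite leq_exp2r // leq_mul2r orbT.
apply: leq_trans (leq_addl _ _); have {H} := H h1 h2.
have a0 : 0 < a by move: n_gt0 na; clear; lia.
have e1 : (n * n * a) ^ 4 = (n ^ 3 * a ^ 3) * (n ^ 5 * a) by clear; nia.
have e2 : m ^ 2 * (K * (m * a * n) ^ 3) = (n ^ 3 * a ^ 3) * (K * m ^ 5) by clear; nia.
rewrite e1 e2 leq_pmul2l ?muln_gt0 ?expn_gt0 ?n_gt0 ?a0 // => h.
have h6 : n ^ 6 <= 2 * (K * m ^ 5).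
  rewrite expnSr; apply: leq_trans (leq_mul (leqnn _) na) _.
  by rewrite mulnCA leq_mul2l h orbT.
(* Squaring n^6 <= 2 K m^5 gives the power m^10 and n^12 >= n^11. *)
apply: (@leq_trans ((n ^ 6) ^ 2)); first by rewrite -expnM leq_pexp2l.
apply: (@leq_trans ((2 * (K * m ^ 5)) ^ 2)); first by rewrite leq_exp2r.
have -> : (2 * (K * m ^ 5)) ^ 2 = 4 * K ^ 2 * (m ^ 5) ^ 2.
  by move: (m ^ 5); clear; nia.
by rewrite -expnM.
Qed.

(** Here [x], [y], [T] are the sizes of A - A, A + A and A^3 + C. The factor [y] is eliminated by
    [y * n ^ 2 <= x ^ 3]; the first alternative covers the failure of a hypothesis of the energy
    bound. *)
Lemma arith_cubes c x y T : n <= 3 * c -> c <= n -> n <= x -> n <= y ->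
  y * n ^ 2 <= x ^ 3 ->
  (36 * (x * y * c) < p ^ 2 -> maxn x y ^ 12 <= (x * y * c) ^ 5 ->
   (n * c) ^ 8 <= T ^ 4 * (16 * c ^ 2 * (K * (x * y * c) ^ 3))) ->
  n ^ 13 <= 36 ^ 3 * x ^ 12 \/ n ^ 17 <= 432 * K * (T ^ 4 * x ^ 12).
Proof.
move=> nc cn nx ny yx H.
have x0 : 0 < x by apply: leq_trans nx.
have y0 : 0 < y by apply: leq_trans ny.
have c0 : 0 < c by move: n_gt0 nc; clear; lia.
have [h1|h1] := ltnP (36 * (x * y * c)) (p ^ 2); last first.
  left; have h : p ^ 2 * n <= 36 * x ^ 4.
    apply: leq_trans (leq_mul h1 (leqnn n)) _; rewrite -mulnA leq_mul2l /=.
    rewrite (expnS x 3) -!mulnA leq_mul2l; apply/orP; right.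
    by apply: leq_trans _ yx; rewrite leq_mul2l -mulnn leq_mul2r cn !orbT.
  rewrite (expnD n 10 3); apply: leq_trans (leq_mul leq_exp10_p6 (leqnn _)) _.
  by rewrite -expnMn (expnM x 4 3) -expnMn leq_exp2r.
have [h2|h2] := leqP (maxn x y ^ 12) ((x * y * c) ^ 5); last first.
  left; have sq z : n <= z -> n ^ 10 <= 3 ^ 5 * (z * c) ^ 5.
    move=> nz; have -> : n ^ 10 = (n ^ 2) ^ 5 by rewrite -expnM.
    rewrite -expnMn leq_exp2r // -mulnn mulnCA; exact: leq_mul.
  (* If [y <= x], even n^30 is bounded by 3^15 x^21; otherwise n^10 <= 3^5 y^7 is combined with y
     n^2 <= x^3. The exponent 24/21 exceeds 13/12. *)
  have h24 : n ^ 24 <= 3 ^ 15 * x ^ 21.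
    have [yx'|xy] := leqP y x.
      move: h2; rewrite (maxn_idPl yx') -mulnA expnMn (expnD x 5 7).
      rewrite ltn_pmul2l ?expn_gt0 ?x0 // => lt.
      have h : n ^ 10 <= 3 ^ 5 * x ^ 7.
        by apply: leq_trans (sq y ny) _; rewrite leq_mul2l ltnW ?orbT.
      apply: (@leq_trans ((n ^ 10) ^ 3)); first by rewrite -expnM leq_pexp2l.
      by rewrite (expnM 3 5 3) (expnM x 7 3) -expnMn leq_exp2r.
    move: h2; rewrite (maxn_idPr (ltnW xy)) [x * y]mulnC -mulnA expnMn (expnD y 5 7).
    rewrite ltn_pmul2l ?expn_gt0 ?y0 // => lt.
    have h : n ^ 10 <= 3 ^ 5 * y ^ 7.
      by apply: leq_trans (sq x nx) _; rewrite leq_mul2l ltnW ?orbT.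
    rewrite (expnD n 10 14); apply: leq_trans (leq_mul h (leqnn _)) _.
    rewrite (expnM n 2 7) -mulnA -expnMn; apply: leq_mul; first by rewrite leq_exp2l.
    by rewrite (expnM x 3 7) leq_exp2r.
  have h13 : n ^ 13 <= 3 ^ 9 * x ^ 12.
    rewrite -(leq_exp2r _ _ (isT : 0 < 7)) expnMn -!expnM.
    apply: (@leq_trans ((n ^ 24) ^ 4)); first by rewrite -expnM leq_pexp2l.
    apply: (@leq_trans ((3 ^ 15 * x ^ 21) ^ 4)); first by rewrite leq_exp2r.
    have aux t : 0 < t -> (t ^ 15 * x ^ 21) ^ 4 <= t ^ (9 * 7) * x ^ (12 * 7).
      by move=> t0; rewrite expnMn -!expnM leq_mul // leq_pexp2l.
    exact: aux.
  apply: leq_trans h13 _; rewrite leq_mul2r; apply/orP; right.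
  by rewrite (expnM 3 3 3) leq_exp2r.
right; have {H} := H h1 h2.
have e1 : (n * c) ^ 8 = c ^ 5 * (n ^ 8 * c ^ 3).
  by rewrite expnMn (expnD c 5 3) mulnCA.
have e2 : T ^ 4 * (16 * c ^ 2 * (K * (x * y * c) ^ 3)) =
    c ^ 5 * (16 * K * (T ^ 4 * (x ^ 3 * y ^ 3))).
  by rewrite !expnMn (expnD c 2 3); move: (x ^ 3) (y ^ 3) (c ^ 2) (c ^ 3) (T ^ 4); clear; nia.
rewrite e1 e2 leq_pmul2l ?expn_gt0 ?c0 // => h.
have h14 : n ^ 14 * c ^ 3 <= 16 * K * (T ^ 4 * x ^ 12).
  rewrite (expnD n 6 8) -mulnA; apply: leq_trans (leq_mul (leqnn _) h) _.
  have core : n ^ 6 * (x ^ 3 * y ^ 3) <= x ^ 12.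
    rewrite mulnCA (expnD x 3 9) leq_mul2l; apply/orP; right.
    by rewrite mulnC (expnM n 2 3) (expnM x 3 3) -expnMn leq_exp2r.
  by rewrite mulnCA leq_mul2l mulnCA leq_mul2l core !orbT.
rewrite (expnD n 14 3).
apply: leq_trans (leq_mul (leqnn _) (_ : n ^ 3 <= (3 * c) ^ 3)) _; first by rewrite leq_exp2r.
rewrite expnMn mulnCA; apply: leq_trans (leq_mul (leqnn _) h14) _.
by rewrite -[3 ^ 3]/27 !mulnA.
Qed.

End Arithmetic.

(** * The four inequalities in integer form *)

Section NatBounds.
Variables (F : fieldType) (p C0 : nat) (A : {fset F}).
Hypotheses (pF : p \in [pchar F]) (leC0 : (72 * 512 <= C0)%N).
Hypotheses (A_gt1 : (1 < #|` A|)%N) (Ap : (#|` A| ^ 5 < p ^ 3)%N).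
Let K := (64 * (C0 + 6) ^ 2)%N.
Let n := #|` A|.

Let n_gt0 : (0 < n)%N. Proof. exact: ltnW. Qed.

Let p_gt3 : (3 < p)%N.
Proof.
rewrite ltnNge; apply/negP => p3.
have n5 : (2 ^ 5 <= n ^ 5)%N by rewrite leq_exp2r.
have p3' : (p ^ 3 <= 3 ^ 3)%N by rewrite leq_exp2r.
by have := leq_trans (leq_ltn_trans n5 Ap) p3'.
Qed.

Let powset_gt0 (d : nat) : (0 < d)%N -> (0 < #|` powset A d|)%N.
Proof.
move=> d0; rewrite lt0n; apply: contraTneq n_gt0 => z.
by have := leq_card_powset A d0; rewrite z muln0 -leqNgt.
Qed.

Lemma nat_sum_squares :
  (#|` A| ^ 8 <= (16 * 36 ^ 3 + 8 * K) *
   (#|` sumset A A| ^ 3 * #|` sumset (powset A 2) (powset A 2)| ^ 4))%N.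
Proof.
apply: (arith_squares n_gt0 Ap (leq_card_powset A (isT : (0 < 2)%N))
  (card_powset A 2)).
- exact/leq_card_sumsetl/(powset_gt0 (d := 2)).
- exact: leq_card_sumsetl.
- move=> h1 h2; apply: (quadratic_bound pF leC0) => //; first exact: ltnW.
  exact: leq_card_sumsetl.
Qed.

Lemma nat_mixed_square :
  (#|` A| ^ 11 <= (36 ^ 10 + 4 * K ^ 2) * #|` sumset A (powset A 2)| ^ 10)%N.
Proof.
have A2 := powset_gt0 (isT : (0 < 2)%N).
apply: (arith_mixed_square n_gt0 Ap (leq_card_powset A (isT : (0 < 2)%N))
  (card_powset A 2)); first exact: leq_card_sumsetl.
move=> h1 h2; rewrite {1}(sumsetC A (powset A 2)).
by apply: (quadratic_bound pF leC0) => //; [apply: ltnW|apply: leq_card_sumsetr].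
Qed.

(** [C] will be the set of cubes of [A] for the sumset of cubes, and [A] itself for the mixed
    sumset. *)
Lemma nat_cubes (C : {fset F}) : (#|` A| <= 3 * #|` C|)%N -> (#|` C| <= #|` A|)%N ->
  (#|` A| ^ 13 <= 36 ^ 3 * #|` diffset A A| ^ 12)%N \/
  (#|` A| ^ 17 <= 432 * K * (#|` sumset (powset A 3) C| ^ 4 * #|` diffset A A| ^ 12))%N.
Proof.
move=> leAC leCA; apply: (arith_cubes n_gt0 Ap leAC leCA (leq_card_diffset A)
  (leq_card_sumsetl A n_gt0) (card_sumset_diffset A)) => h1 h2.
exact: (cubic_bound pF leC0).
Qed.

Lemma nat_sum_cubes :
  (#|` A| ^ 17 <= (36 ^ 3 * 81 + 432 * K) *
    (#|` diffset A A| ^ 3 * #|` sumset (powset A 3) (powset A 3)|) ^ 4)%N.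
Proof.
set D := #|` diffset A A|; set T := #|` sumset _ _|.
have A3 := leq_card_powset A (isT : (0 < 3)%N).
have nT : (n <= 3 * T)%N.
  apply: leq_trans A3 _; rewrite leq_mul2l leq_card_sumsetl //.
  exact: (powset_gt0 (d := 3)).
rewrite expnMn -expnM mulnDl.
have [h|h] := nat_cubes A3 (card_powset A 3).
  apply: leq_trans (leq_addr _ _); rewrite (expnD _ 13 4).
  apply: leq_trans (leq_mul h (_ : (n ^ 4 <= (3 * T) ^ 4)%N)) _.
    by rewrite leq_exp2r.
  by rewrite expnMn -[(3 ^ 4)%N]/81%N mulnACA.
by apply: leq_trans (leq_addl _ _); rewrite (mulnC (D ^ _)%N).
Qed.

(** Ruzsa's inequality gives D n <= 3 m^2. Multiplying by n^12 therefore trades D^12 for m^24. *)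
Lemma nat_mixed_cube :
  (#|` A| ^ 29 <= ((432 * K + 36 ^ 3) * 3 ^ 12) * #|` sumset A (powset A 3)| ^ 28)%N.
Proof.
set m := #|` sumset _ _|; set D := #|` diffset A A|.
have A3 := leq_card_powset A (isT : (0 < 3)%N).
have nm : (n <= m)%N by apply: leq_card_sumsetl; apply: (powset_gt0 (d := 3)).
have Dn : (D * n <= 3 * m ^ 2)%N.
  apply: leq_trans (leq_mul (leqnn _) A3) _; rewrite mulnCA leq_mul2l /=.
  exact: ruzsa_triangle.
have Dn12 : (D ^ 12 * n ^ 12 <= 3 ^ 12 * m ^ 24)%N.
  by rewrite (expnM m 2 12) -!expnMn leq_exp2r.
have := nat_cubes (leq_pmull n (isT : (0 < 3)%N)) (leqnn n).
rewrite sumsetC -/m -/D -/n; move: (432 * K)%N (3 ^ 12)%N (36 ^ 3)%N Dn12 => k t r Dn12 [h|h].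
  rewrite (expnD n 25 4) (expnD n 13 12) (expnD m 24 4) mulnA; apply: leq_mul.
    apply: leq_trans (leq_mul h (leqnn _)) _; rewrite -mulnA.
    apply: leq_trans (leq_mul (leqnn r) Dn12) _; rewrite mulnA leq_mul2r leq_mul2r.
    by rewrite leq_addl !orbT.
  by rewrite leq_exp2r.
rewrite (expnD n 17 12) (expnD m 4 24); apply: leq_trans (leq_mul h (leqnn _)) _.
rewrite -mulnA -[(_ * _ * n ^ 12)%N]mulnA.
apply: leq_trans (leq_mul (leqnn k) (leq_mul (leqnn (m ^ 4)%N) Dn12)) _.
by rewrite (mulnCA (m ^ 4)%N) mulnA leq_mul2r leq_mul2r leq_addr !orbT.
Qed.

End NatBounds.

Lemma powR_ratio_exp (R : realType) (x : R) (a b : nat) : 0 <= x -> (0 < b)%N ->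
  (x `^ (a%:R / b%:R)) ^+ b = x ^+ a.
Proof.
move=> x0 b0; rewrite -[LHS]powR_mulrn ?powR_ge0 // -powRrM divfK ?powR_mulrn //.
by rewrite pnatr_eq0 -lt0n.
Qed.

(** Compare b-th powers, using c^b <= c for c <= 1. *)
Lemma powR_bound (R : realType) (c : R) (n m a b C : nat) :
  0 < c -> c <= 1 -> c * C%:R <= 1 -> (0 < b)%N -> (n ^ a <= C * m ^ b)%N ->
  c * n%:R `^ (a%:R / b%:R) <= m%:R.
Proof.
move=> c0 c1 cC b0 h; have cge0 := ltW c0.
rewrite -(ler_pXn2r b0) ?nnegrE ?mulr_ge0 ?powR_ge0 ?ler0n //.
rewrite exprMn powR_ratio_exp ?ler0n // -!natrX.
apply: (@le_trans _ _ (c * (C * m ^ b)%N%:R)).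
  apply: ler_pM; rewrite ?exprn_ge0 ?ler0n ?ler_nat //.
  by case: (b) b0 => // b' _; rewrite exprS ler_piMr ?exprn_ile1.
by rewrite natrM mulrA ler_piMl.
Qed.

Theorem proposition12 (R : realType) :
  exists2 c : R, 0 < c &
  forall (F : fieldType) (p : nat) (A : {fset F}),
    p \in [pchar F] -> odd p ->
    0 \notin A ->
    (1 < #|` A|)%N ->
    (#|` A|)%:R < (p%:R : R) `^ (3 / 5) ->
    (c * (#|` A|)%:R ^+ 8 <=
       (#|` sumset A A|)%:R ^+ 3 *
       (#|` sumset (powset A 2) (powset A 2)|)%:R ^+ 4
     /\
     c * (#|` A|)%:R `^ (11 / 10) <= (#|` sumset A (powset A 2)|)%:R)
    /\
    (c * (#|` A|)%:R `^ (17 / 4) <=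
       (#|` diffset A A|)%:R ^+ 3 *
       (#|` sumset (powset A 3) (powset A 3)|)%:R
     /\
     c * (#|` A|)%:R `^ (29 / 28) <= (#|` sumset A (powset A 3)|)%:R).
Proof.
(* The constants enter as abstract variables, which keeps large numerals from being unfolded. *)
have [C0 leC0] : exists C0, (72 * 512 <= C0)%N by exists (72 * 512)%N.
have [K defK] : exists K, K = (64 * (C0 + 6) ^ 2)%N := ex_intro _ _ erefl.
have [C1 def1] : exists C, C = (16 * 36 ^ 3 + 8 * K)%N := ex_intro _ _ erefl.
have [C2 def2] : exists C, C = (36 ^ 10 + 4 * K ^ 2)%N := ex_intro _ _ erefl.
have [C3 def3] : exists C, C = (36 ^ 3 * 81 + 432 * K)%N := ex_intro _ _ erefl.
have [C4 def4] : exists C, C = ((432 * K + 36 ^ 3) * 3 ^ 12)%N := ex_intro _ _ erefl.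
pose c : R := (1 + (C1 + C2 + C3 + C4)%N%:R)^-1.
have den : 0 < 1 + (C1 + C2 + C3 + C4)%N%:R :> R by rewrite ltr_wpDr ?ler0n.
have c0 : 0 < c by rewrite invr_gt0.
have cC C : (C <= C1 + C2 + C3 + C4)%N -> c * C%:R <= 1.
  by move=> hC; rewrite /c mulrC ler_pdivrMr // mul1r ler_wpDl // ler_nat.
have c1 : c <= 1 by rewrite invf_le1 // lerDl ler0n.
exists c => // F p A pF p_odd _ A1 Ap.
have {}Ap : (#|` A| ^ 5 < p ^ 3)%N.
  rewrite -(ltr_nat R) !natrX; have : (#|` A|)%:R ^+ 5 < (p%:R `^ (3 / 5)) ^+ 5 :> R.
    by rewrite ltr_pXn2r // nnegrE ?powR_ge0 ?ler0n.
  by rewrite (powR_ratio_exp 3) ?ler0n.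
split; split.
- apply: (@le_trans _ _ (c * (C1 * (#|` sumset A A| ^ 3 * #|` sumset (powset A 2) (powset A 2)| ^ 4))%N%:R)).
    by rewrite ler_pM2l // -natrX ler_nat def1 defK; apply: nat_sum_squares pF leC0 A1 Ap.
  rewrite natrM mulrA -!natrX -natrM ler_piMl // cC //.
  by rewrite -!addnA leq_addr.
- apply: (powR_bound c0 c1 (cC C2 _)) => //; last first.
    by rewrite def2 defK; apply: nat_mixed_square pF leC0 A1 Ap.
  by rewrite (addnC C1) -!addnA leq_addr.
- rewrite -natrX -natrM.
  apply: (powR_bound c0 c1 (cC C3 _)) => //; last first.
    by rewrite def3 defK; apply: nat_sum_cubes pF leC0 A1 Ap.
  by rewrite (addnC _ C3) -!addnA leq_addr.
- apply: (powR_bound c0 c1 (cC C4 _)) => //; last first.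
    by rewrite def4 defK; apply: nat_mixed_cube pF leC0 A1 Ap.
  exact: leq_addl.
Qed.
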